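(* Let $N>4$ be an integer. Consider the magnetic geodesic flow on the 2-torus with Riemannian metric $ds^2=\Lambda(x,y)(dx^2+dy^2)$ and a non-zero magnetic field $\Omega$ (i.e. $\Omega\not\equiv 0$). Suppose that this flow admits an additional polynomial in momenta first integral $F$ of degree $N$ with (real-)analytic periodic coefficients on $N+2$ different energy levels $\{H=E_1\},\ldots,\{H=E_{N+2}\}$ ($E_1,\dots,E_{N+2}$ pairwise distinct). Then the magnetic field and the metric are functions of one variable and there exists a linear in momenta first integral $F_1$ of this flow on all energy levels.
   Context: The 2-torus is $\mathbb{T}^2=\mathbb{R}^2/\Gamma$ ($\Gamma$ a lattice) with global conformal coordinates $(x,y)=(x^1,x^2)$ in which the metric is $ds^2=\Lambda(x,y)(dx^2+dy^2)$, $\Lambda>0$; $p_1,p_2$ are the conjugate momenta; $\Omega(x,y)$ is the magnetic field. ''Periodic'' means $\Gamma$-periodic; $\Lambda,\Omega$ are smooth, real-valued and periodic. The Hamiltonian is $H=\frac{p_1^2+p_2^2}{2\Lambda}$ and the magnetic Poisson bracket is $$\{F,H\}_{mg}=\sum_{i=1}^2\left(\frac{\partial F}{\partial x^i}\frac{\partial H}{\partial p_i}-\frac{\partial F}{\partial p_i}\frac{\partial H}{\partial x^i}\right)+\Omega(x^1,x^2)\left(\frac{\partial F}{\partial p_1}\frac{\partial H}{\partial p_2}-\frac{\partial F}{\partial p_2}\frac{\partial H}{\partial p_1}\right).$$ The magnetic geodesic flow is the flow of $\dot x^j=\{x^j,H\}_{mg}$, $\dot p_j=\{p_j,H\}_{mg}$,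 $j=1,2$. A function $F(x,y,p_1,p_2)$ is a first integral on the energy level $\{H=E\}$ ($E>0$) if $\{F,H\}_{mg}=0$ at every point with $H=E$; it is a first integral on all energy levels if $\{F,H\}_{mg}\equiv 0$. A polynomial in momenta of degree $N$ is $F=\sum_{s=0}^N\sum_{k=0}^s a_{s,k}(x,y)p_1^{s-k}p_2^k$ with real-valued periodic coefficients, not all $a_{N,k}$ identically zero; linear in momenta means degree 1. ''Additional'' means independent of $H$: $F$ is not constant on the energy levels under consideration. ''The magnetic field and metric are functions of one variable'' means that there is a nonzero $(\alpha,\beta)\in\mathbb{R}^2$ such that both $\Omega$ and $\Lambda$ depend only on $\alpha x+\beta y$ (equivalently, after a rotation of the coordinates $(x,y)$, both depend only on $y$). *)

(* Defs.v *)
From Stdlib Require Export Reals.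
From Coquelicot Require Export Coquelicot.

Open Scope R_scope.

(** Functions on the torus R^2/Gamma are represented by Gamma-periodic functions
    on R^2, and functions on its cotangent bundle by functions of
    (x, y, p1, p2). *)

Definition is_lattice (Gamma : R * R -> Prop) : Prop :=
  exists u v : R * R,
    fst u * snd v - snd u * fst v <> 0 /\
    forall w : R * R,
      Gamma w <->
      exists m n : Z, w = (IZR m * fst u + IZR n * fst v,
                           IZR m * snd u + IZR n * snd v).

Definition periodic (Gamma : R * R -> Prop) (f : R -> R -> R) : Prop :=
  forall w : R * R, Gamma w ->
    forall x y : R, f (x + fst w) (y + snd w) = f x y.

Definition smooth (f : R -> R -> R) : Prop :=
  forall (n : nat) (x y : R), ex_diff_n f n x y.

(** The Taylor series is summed over the total degree [n]; the first conjunct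
    is the absolute convergence of the double series, so the order of
    summation is immaterial. *)
Definition real_analytic (f : R -> R -> R) : Prop :=
  forall x0 y0 : R, exists (c : nat -> nat -> R) (r : R), 0 < r /\
    forall x y : R, Rabs (x - x0) < r -> Rabs (y - y0) < r ->
      let term n k := c (n - k)%nat k * (x - x0) ^ (n - k) * (y - y0) ^ k in
      ex_series (fun n => sum_f_R0 (fun k => Rabs (term n k)) n) /\
      is_series (fun n => sum_f_R0 (fun k => term n k) n) (f x y).

Definition hamiltonian (Lambda : R -> R -> R) (x y p1 p2 : R) : R :=
  (p1 ^ 2 + p2 ^ 2) / (2 * Lambda x y).

Definition d_x (F : R -> R -> R -> R -> R) (x y p1 p2 : R) : R :=
  Derive (fun t => F t y p1 p2) x.
Definition d_y (F : R -> R -> R -> R -> R) (x y p1 p2 : R) : R :=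
  Derive (fun t => F x t p1 p2) y.
Definition d_p1 (F : R -> R -> R -> R -> R) (x y p1 p2 : R) : R :=
  Derive (fun t => F x y t p2) p1.
Definition d_p2 (F : R -> R -> R -> R -> R) (x y p1 p2 : R) : R :=
  Derive (fun t => F x y p1 t) p2.

Definition magnetic_bracket (Omega : R -> R -> R)
    (F G : R -> R -> R -> R -> R) (x y p1 p2 : R) : R :=
  (d_x F x y p1 p2 * d_p1 G x y p1 p2 - d_p1 F x y p1 p2 * d_x G x y p1 p2) +
  (d_y F x y p1 p2 * d_p2 G x y p1 p2 - d_p2 F x y p1 p2 * d_y G x y p1 p2) +
  Omega x y *
  (d_p1 F x y p1 p2 * d_p2 G x y p1 p2 - d_p2 F x y p1 p2 * d_p1 G x y p1 p2).

Definition first_integral_on_level (Lambda Omega : R -> R -> R)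
    (F : R -> R -> R -> R -> R) (E : R) : Prop :=
  forall x y p1 p2 : R, hamiltonian Lambda x y p1 p2 = E ->
    magnetic_bracket Omega F (hamiltonian Lambda) x y p1 p2 = 0.

Definition first_integral_on_all_levels (Lambda Omega : R -> R -> R)
    (F : R -> R -> R -> R -> R) : Prop :=
  forall x y p1 p2 : R,
    magnetic_bracket Omega F (hamiltonian Lambda) x y p1 p2 = 0.

Definition constant_on_level (Lambda : R -> R -> R)
    (F : R -> R -> R -> R -> R) (E : R) : Prop :=
  exists c : R, forall x y p1 p2 : R,
    hamiltonian Lambda x y p1 p2 = E -> F x y p1 p2 = c.

Definition polynomial_in_momenta (coef_regularity : (R -> R -> R) -> Prop)
    (Gamma : R * R -> Prop) (N : nat) (F : R -> R -> R -> R -> R) : Prop :=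
  exists a : nat -> nat -> R -> R -> R,
    (forall s k : nat, (k <= s <= N)%nat ->
       periodic Gamma (a s k) /\ coef_regularity (a s k)) /\
    (exists k : nat, (k <= N)%nat /\ exists x y : R, a N k x y <> 0) /\
    forall x y p1 p2 : R,
      F x y p1 p2 =
      sum_f_R0 (fun s =>
        sum_f_R0 (fun k => a s k x y * p1 ^ (s - k) * p2 ^ k) s) N.

Definition depends_only_on (alpha beta : R) (f : R -> R -> R) : Prop :=
  exists g : R -> R, forall x y : R, f x y = g (alpha * x + beta * y).

(* Main.v *)
Require Import Defs.
From Stdlib Require Import Reals.
From Coquelicot Require Import Coquelicot.
From Stdlib Require Import Arith Factorial Lra Lia.

(** A homogeneous polynomial of degree at most [N + 1] in the momenta that vanishes on [N + 2]
    energy levels vanishes identically, so [F] is an integral on all levels.  Write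
    [xi = p1 + i p2], [eta = p1 - i p2] and [d = (d_x - i d_y) / 2], let [j] be the least power
    of [eta] occurring with a higher power of [xi] in [F], and let [g_m] be the coefficient of
    [xi^(m+j) eta^j] times [Lambda^j].  Then [d g_m = i (m + 1) Omega g_(m+1)].  The top
    [g_m] is a nonzero constant by Liouville, so the next one is a multiple of a periodic
    potential [h], [d h = Omega], and every [e_m = i^m m! g_m] is a polynomial in [h] with
    [e_m' = e_(m+1)].

    Since [e_0] is real, [h] satisfies [V . grad h = 0] with [V = (Im e_1, Re e_1)] a function
    of [h].  Hence [e_1], [h] and [V] are constant along the full line through each point in the
    direction of [V]; nonparallel lines in the plane meet, so all these lines are parallel to
    one vector [v].  The equation of weight zero says that [Lambda V] is divergence free, which
    gives [v . grad Lambda = 0].  Both identities hold where [e_1 <> 0], a dense set because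
    [e_1] is [Lambda^j] times a nonzero analytic function.  The linear integral is
    [v . p + (v_2 Re h - v_1 Im h) / 2]. *)

(** * Functions of two variables with continuous gradient *)

(** The least [j] is chosen so that its row closes up. In the bracket, row [j] meets only itself and
    row [j - 1], and the chain equations contain row [j - 1] only through coefficients that vanish
    by minimality. Such a row exists: otherwise [F] is a sum of terms [b (xi eta)^k], Liouville
    makes every [b Lambda^k] constant, and [F] is constant on each level. Reality of [F] makes [e_0]
    real and turns the other neighbour in the equation of weight zero into the conjugate of the
    coefficient in row [j], so that this equation speaks of [e_1] alone. The equation for [e_1] is
    quasilinear, [V . grad e_1 = 0] with [V] read off from [e_1] itself, and this is why its
    characteristics are straight. The obstacle is the zero set of [e_1], where [V] has no direction.
    If [e_1] vanished identically, the chain would kill the nonzero constant top coefficient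
    wherever [Omega <> 0]; analyticity then rules out zeros on an open set. *)

Definition has_grad (f fx fy : R -> R -> R) : Prop :=
  (forall x y, is_derive (fun t => f t y) x (fx x y)) /\
  (forall x y, is_derive (fun t => f x t) y (fy x y)) /\
  (forall x y, continuity_2d_pt fx x y) /\
  (forall x y, continuity_2d_pt fy x y).

Lemma has_grad_differentiable f fx fy x y :
  has_grad f fx fy -> differentiable_pt_lim f x y (fx x y) (fy x y).
Proof.
  intros (Hx & Hy & Cx & Cy).
  apply filterdiff_differentiable_pt_lim.
  apply filterdiff_ext_lin
    with (fun u : R * R => plus (scal (fst u) (fx x y)) (scal (snd u) (fy x y))).
  - apply is_derive_filterdiff.
    + apply filter_forall; intros [a b]; simpl; apply Hx.
    + apply Hy.
    + apply continuity_2d_pt_filterlim, Cx.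
  - intros [a b]; reflexivity.
Qed.

Lemma has_grad_continuity f fx fy x y : has_grad f fx fy -> continuity_2d_pt f x y.
Proof.
  intros H; apply differentiable_continuity_pt.
  exists (fx x y), (fy x y); now apply has_grad_differentiable.
Qed.

Lemma is_derive_curve f fx fy a b t da db :
  has_grad f fx fy -> is_derive a t da -> is_derive b t db ->
  is_derive (fun s => f (a s) (b s)) t (fx (a t) (b t) * da + fy (a t) (b t) * db).
Proof.
  intros H Ha Hb; apply is_derive_Reals, derivable_pt_lim_comp_2d.
  - now apply has_grad_differentiable.
  - now apply is_derive_Reals.
  - now apply is_derive_Reals.
Qed.

Lemma is_derive_line f fx fy x y v1 v2 t :
  has_grad f fx fy ->
  is_derive (fun s => f (x + s * v1) (y + s * v2)) t
    (fx (x + t * v1) (y + t * v2) * v1 + fy (x + t * v1) (y + t * v2) * v2).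
Proof.
  intros H.
  apply (is_derive_curve f fx fy (fun s => x + s * v1) (fun s => y + s * v2)).
  - exact H.
  - auto_derive; trivial; ring.
  - auto_derive; trivial; ring.
Qed.

Lemma has_grad_ext f g fx fy gx gy :
  (forall x y, f x y = g x y) -> (forall x y, fx x y = gx x y) ->
  (forall x y, fy x y = gy x y) -> has_grad f fx fy -> has_grad g gx gy.
Proof.
  intros E Ex Ey (Hx & Hy & Cx & Cy); refine (conj _ (conj _ (conj _ _))); intros x y.
  - rewrite <- Ex; apply is_derive_ext with (2 := Hx x y); intros; apply E.
  - rewrite <- Ey; apply is_derive_ext with (2 := Hy x y); intros; apply E.
  - apply continuity_2d_pt_ext with (2 := Cx x y); intros; apply Ex.
  - apply continuity_2d_pt_ext with (2 := Cy x y); intros; apply Ey.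
Qed.

Lemma has_grad_unique f fx fy gx gy x y :
  has_grad f fx fy -> has_grad f gx gy -> fx x y = gx x y /\ fy x y = gy x y.
Proof.
  intros (Hx & Hy & _) (Gx & Gy & _); split.
  - now rewrite <- (is_derive_unique _ _ _ (Hx x y)), <- (is_derive_unique _ _ _ (Gx x y)).
  - now rewrite <- (is_derive_unique _ _ _ (Hy x y)), <- (is_derive_unique _ _ _ (Gy x y)).
Qed.

Lemma has_grad_const c : has_grad (fun _ _ => c) (fun _ _ => 0) (fun _ _ => 0).
Proof.
  refine (conj _ (conj _ (conj _ _))); intros x y;
    try apply continuity_2d_pt_const; apply @is_derive_const.
Qed.

Lemma has_grad_fst : has_grad (fun x _ => x) (fun _ _ => 1) (fun _ _ => 0).
Proof.
  refine (conj _ (conj _ (conj _ _))); intros x y; try apply continuity_2d_pt_const.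
  - apply @is_derive_id.
  - apply @is_derive_const.
Qed.

Lemma has_grad_snd : has_grad (fun _ y => y) (fun _ _ => 0) (fun _ _ => 1).
Proof.
  refine (conj _ (conj _ (conj _ _))); intros x y; try apply continuity_2d_pt_const.
  - apply @is_derive_const.
  - apply @is_derive_id.
Qed.

Lemma has_grad_plus f fx fy g gx gy :
  has_grad f fx fy -> has_grad g gx gy ->
  has_grad (fun x y => f x y + g x y) (fun x y => fx x y + gx x y)
    (fun x y => fy x y + gy x y).
Proof.
  intros (Hx & Hy & Cx & Cy) (Gx & Gy & Dx & Dy); refine (conj _ (conj _ (conj _ _))); intros x y.
  - apply (@is_derive_plus R_AbsRing R_NormedModule); auto.
  - apply (@is_derive_plus R_AbsRing R_NormedModule); auto.
  - now apply continuity_2d_pt_plus.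
  - now apply continuity_2d_pt_plus.
Qed.

Lemma has_grad_mult f fx fy g gx gy :
  has_grad f fx fy -> has_grad g gx gy ->
  has_grad (fun x y => f x y * g x y)
    (fun x y => fx x y * g x y + f x y * gx x y)
    (fun x y => fy x y * g x y + f x y * gy x y).
Proof.
  intros Hf Hg.
  pose proof (fun x y => has_grad_continuity _ _ _ x y Hf) as Cf.
  pose proof (fun x y => has_grad_continuity _ _ _ x y Hg) as Cg.
  destruct Hf as (Hx & Hy & Cx & Cy), Hg as (Gx & Gy & Dx & Dy).
  refine (conj _ (conj _ (conj _ _))); intros x y.
  - apply (is_derive_mult (fun t => f t y) (fun t => g t y)); auto.
    intros; apply Rmult_comm.
  - apply (is_derive_mult (fun t => f x t) (fun t => g x t)); auto.
    intros; apply Rmult_comm.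
  - apply continuity_2d_pt_plus; apply continuity_2d_pt_mult; auto.
  - apply continuity_2d_pt_plus; apply continuity_2d_pt_mult; auto.
Qed.

Lemma has_grad_scal c f fx fy :
  has_grad f fx fy ->
  has_grad (fun x y => c * f x y) (fun x y => c * fx x y) (fun x y => c * fy x y).
Proof.
  intros H; apply has_grad_ext with (4 := has_grad_mult _ _ _ _ _ _ (has_grad_const c) H);
    intros; ring.
Qed.

Lemma has_grad_opp f fx fy :
  has_grad f fx fy ->
  has_grad (fun x y => - f x y) (fun x y => - fx x y) (fun x y => - fy x y).
Proof.
  intros H; apply has_grad_ext with (4 := has_grad_scal (-1) _ _ _ H); intros; ring.
Qed.

Lemma has_grad_inv f fx fy :
  (forall x y, f x y <> 0) -> has_grad f fx fy ->
  has_grad (fun x y => / f x y) (fun x y => - fx x y / f x y ^ 2)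
    (fun x y => - fy x y / f x y ^ 2).
Proof.
  intros N Hf.
  pose proof (fun x y => has_grad_continuity _ _ _ x y Hf) as Cf.
  destruct Hf as (Hx & Hy & Cx & Cy).
  assert (C2 : forall x y, continuity_2d_pt (fun u v => / f u v ^ 2) x y).
  { intros x y; apply continuity_2d_pt_inv; [| now apply pow_nonzero].
    apply continuity_2d_pt_ext with (fun u v => f u v * f u v).
    - intros; ring.
    - now apply continuity_2d_pt_mult. }
  refine (conj _ (conj _ (conj _ _))); intros x y.
  - apply (is_derive_inv (fun t => f t y)); auto.
  - apply (is_derive_inv (fun t => f x t)); auto.
  - apply continuity_2d_pt_mult; auto; now apply continuity_2d_pt_opp.
  - apply continuity_2d_pt_mult; auto; now apply continuity_2d_pt_opp.
Qed.

Lemma smooth_has_grad f :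
  smooth f ->
  has_grad f (fun x y => Derive (fun t => f t y) x) (fun x y => Derive (fun t => f x t) y).
Proof.
  intros H; refine (conj _ (conj _ (conj _ _))); intros x y;
    destruct (H 1%nat x y) as (_ & Ex & Ey & Dx & Dy).
  - now apply Derive_correct.
  - now apply Derive_correct.
  - apply Dx.
  - apply Dy.
Qed.

Lemma ex_diff_n_const c n x y : ex_diff_n (fun _ _ => c) n x y.
Proof.
  revert c x y; induction n as [|n IH]; intros c x y; simpl.
  - split; trivial; apply continuity_2d_pt_const.
  - refine (conj _ (conj _ (conj _ (conj _ _)))).
    + apply continuity_2d_pt_const.
    + apply @ex_derive_const.
    + apply @ex_derive_const.
    + apply ex_diff_n_ext_loc with (fun _ _ => 0); [|apply IH].
      apply locally_2d_forall; intros; now rewrite Derive_const.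
    + apply ex_diff_n_ext_loc with (fun _ _ => 0); [|apply IH].
      apply locally_2d_forall; intros; now rewrite Derive_const.
Qed.

Lemma ex_diff_n_scal c n f :
  (forall x y, ex_diff_n f n x y) -> forall x y, ex_diff_n (fun u v => c * f u v) n x y.
Proof.
  revert f; induction n as [|n IH]; intros f H x y; simpl.
  - split; trivial; apply continuity_2d_pt_mult; [apply continuity_2d_pt_const|apply H].
  - destruct (H x y) as (C & Ex & Ey & _).
    refine (conj _ (conj _ (conj _ (conj _ _)))).
    + apply continuity_2d_pt_mult; [apply continuity_2d_pt_const|apply C].
    + now apply (ex_derive_scal (fun z => f z y)).
    + now apply (ex_derive_scal (fun z => f x z)).
    + apply ex_diff_n_ext_loc with (fun u v => c * Derive (fun z => f z v) u).
      * apply locally_2d_forall; intros; now rewrite Derive_scal.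
      * apply (IH (fun u v => Derive (fun z => f z v) u)); intros u v; apply (H u v).
    + apply ex_diff_n_ext_loc with (fun u v => c * Derive (fun z => f u z) v).
      * apply locally_2d_forall; intros; now rewrite Derive_scal.
      * apply (IH (fun u v => Derive (fun z => f u z) v)); intros u v; apply (H u v).
Qed.

(** Meant for the constant term of the linear integral: it is built from a potential recorded only
    as C^1, but its gradient is a constant multiple of the smooth [Omega]. *)
Lemma smooth_of_grad f fx fy : has_grad f fx fy -> smooth fx -> smooth fy -> smooth f.
Proof.
  intros H Sx Sy n x y.
  pose proof (has_grad_continuity _ _ _ x y H) as C.
  destruct H as (Hx & Hy & _).
  destruct n as [|n]; simpl; [easy|].
  refine (conj C (conj _ (conj _ (conj _ _)))).
  - eexists; apply Hx.
  - eexists; apply Hy.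
  - apply ex_diff_n_ext_loc with fx; [|apply Sx].
    apply locally_2d_forall; intros; symmetry; now apply is_derive_unique.
  - apply ex_diff_n_ext_loc with fy; [|apply Sy].
    apply locally_2d_forall; intros; symmetry; now apply is_derive_unique.
Qed.

Lemma smooth_const c : smooth (fun _ _ => c).
Proof. intros n x y; apply ex_diff_n_const. Qed.

Lemma smooth_scal c f : smooth f -> smooth (fun x y => c * f x y).
Proof. intros H n x y; apply ex_diff_n_scal; intros; apply H. Qed.

(** The gradient is carried as explicit functions, so that sums, products and powers are
    differentiated by algebra alone; [has_cgrad_unique] compares two gradients of one function. *)
Definition has_cgrad (f fx fy : R -> R -> C) : Prop :=
  has_grad (fun x y => Re (f x y)) (fun x y => Re (fx x y)) (fun x y => Re (fy x y)) /\
  has_grad (fun x y => Im (f x y)) (fun x y => Im (fx x y)) (fun x y => Im (fy x y)).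

Lemma C_ext (z w : C) : Re z = Re w -> Im z = Im w -> z = w.
Proof. destruct z, w; simpl; congruence. Qed.

Lemma has_cgrad_ext f g fx fy gx gy :
  (forall x y, f x y = g x y) -> (forall x y, fx x y = gx x y) ->
  (forall x y, fy x y = gy x y) -> has_cgrad f fx fy -> has_cgrad g gx gy.
Proof.
  intros E Ex Ey [H1 H2]; split.
  - apply has_grad_ext with (4 := H1); intros; now f_equal.
  - apply has_grad_ext with (4 := H2); intros; now f_equal.
Qed.

Lemma has_cgrad_unique f fx fy gx gy x y :
  has_cgrad f fx fy -> has_cgrad f gx gy -> fx x y = gx x y /\ fy x y = gy x y.
Proof.
  intros [H1 H2] [K1 K2].
  destruct (has_grad_unique _ _ _ _ _ x y H1 K1), (has_grad_unique _ _ _ _ _ x y H2 K2).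
  now split; apply C_ext.
Qed.

Lemma has_cgrad_const (c : C) : has_cgrad (fun _ _ => c) (fun _ _ => 0) (fun _ _ => 0).
Proof. split; apply has_grad_const. Qed.

Lemma has_cgrad_RtoC f fx fy :
  has_grad f fx fy ->
  has_cgrad (fun x y => RtoC (f x y)) (fun x y => RtoC (fx x y)) (fun x y => RtoC (fy x y)).
Proof. intros H; split; [exact H|exact (has_grad_const 0)]. Qed.

Lemma has_cgrad_conj f fx fy :
  has_cgrad f fx fy ->
  has_cgrad (fun x y => Cconj (f x y)) (fun x y => Cconj (fx x y)) (fun x y => Cconj (fy x y)).
Proof. intros [H1 H2]; split; [exact H1|now apply has_grad_opp in H2]. Qed.

Lemma has_cgrad_plus f fx fy g gx gy :
  has_cgrad f fx fy -> has_cgrad g gx gy ->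
  has_cgrad (fun x y => f x y + g x y)%C (fun x y => fx x y + gx x y)%C
    (fun x y => fy x y + gy x y)%C.
Proof.
  intros [H1 H2] [K1 K2]; split.
  - exact (has_grad_plus _ _ _ _ _ _ H1 K1).
  - exact (has_grad_plus _ _ _ _ _ _ H2 K2).
Qed.

Lemma has_cgrad_mult f fx fy g gx gy :
  has_cgrad f fx fy -> has_cgrad g gx gy ->
  has_cgrad (fun x y => f x y * g x y)%C (fun x y => fx x y * g x y + f x y * gx x y)%C
    (fun x y => fy x y * g x y + f x y * gy x y)%C.
Proof.
  intros [H1 H2] [K1 K2]; split.
  - apply has_grad_ext
      with (4 := has_grad_plus _ _ _ _ _ _ (has_grad_mult _ _ _ _ _ _ H1 K1)
                   (has_grad_opp _ _ _ (has_grad_mult _ _ _ _ _ _ H2 K2)));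
      intros; unfold Re, Im; simpl; ring.
  - apply has_grad_ext
      with (4 := has_grad_plus _ _ _ _ _ _ (has_grad_mult _ _ _ _ _ _ H1 K2)
                   (has_grad_mult _ _ _ _ _ _ H2 K1));
      intros; unfold Re, Im; simpl; ring.
Qed.

Lemma has_cgrad_scal (c : C) f fx fy :
  has_cgrad f fx fy ->
  has_cgrad (fun x y => c * f x y)%C (fun x y => c * fx x y)%C (fun x y => c * fy x y)%C.
Proof.
  intros H.
  apply has_cgrad_ext with (4 := has_cgrad_mult _ _ _ _ _ _ (has_cgrad_const c) H);
    intros; ring.
Qed.

Lemma has_cgrad_minus f fx fy g gx gy :
  has_cgrad f fx fy -> has_cgrad g gx gy ->
  has_cgrad (fun x y => f x y - g x y)%C (fun x y => fx x y - gx x y)%C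
    (fun x y => fy x y - gy x y)%C.
Proof.
  intros H K.
  apply has_cgrad_ext with (4 := has_cgrad_plus _ _ _ _ _ _ H (has_cgrad_scal (-1) _ _ _ K));
    intros; ring.
Qed.

Lemma has_cgrad_pow n f fx fy :
  has_cgrad f fx fy ->
  has_cgrad (fun x y => f x y ^ n)%C
    (fun x y => INR n * f x y ^ pred n * fx x y)%C
    (fun x y => INR n * f x y ^ pred n * fy x y)%C.
Proof.
  intros H; induction n as [|n IH].
  - apply has_cgrad_ext with (4 := has_cgrad_const 1); intros; simpl; ring.
  - apply has_cgrad_ext with (4 := has_cgrad_mult _ _ _ _ _ _ H IH); intros x y.
    + reflexivity.
    + rewrite S_INR, RtoC_plus; destruct n; simpl; ring.
    + rewrite S_INR, RtoC_plus; destruct n; simpl; ring.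
Qed.

Lemma has_cgrad_locally_const f fx fy x y (c : C) :
  has_cgrad f fx fy -> locally_2d (fun u v => f u v = c) x y ->
  fx x y = 0 /\ fy x y = 0.
Proof.
  assert (A : forall g gx gy (b : R), has_grad g gx gy ->
    locally_2d (fun u v => g u v = b) x y -> gx x y = 0 /\ gy x y = 0).
  { intros g gx gy b Hg Hb.
    pose proof (has_grad_differentiable _ _ _ x y Hg) as D.
    apply (differentiable_pt_lim_ext _ (fun _ _ => b)) in D; [|exact Hb].
    pose proof (has_grad_differentiable _ _ _ x y (has_grad_const b)) as D0.
    apply differentiable_pt_lim_unique in D.
    apply differentiable_pt_lim_unique in D0.
    destruct D, D0; split; congruence. }
  intros [H1 H2] [d L].
  destruct (A _ _ _ (Re c) H1) as [E1 E2]; [|destruct (A _ _ _ (Im c) H2) as [E3 E4]].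
  - exists d; intros; f_equal; now apply L.
  - exists d; intros; f_equal; now apply L.
  - split; now apply C_ext.
Qed.

Lemma has_grad_const_line f fx fy x y v1 v2 :
  has_grad f fx fy ->
  (forall t, fx (x + t * v1) (y + t * v2) * v1 + fy (x + t * v1) (y + t * v2) * v2 = 0) ->
  forall t, f (x + t * v1) (y + t * v2) = f x y.
Proof.
  intros H Z t.
  assert (D : forall s, is_derive (fun s => f (x + s * v1) (y + s * v2)) s 0).
  { intros s; rewrite <- (Z s); now apply is_derive_line. }
  replace (f x y) with (f (x + 0 * v1) (y + 0 * v2)) by (f_equal; ring).
  destruct (MVT_gen (fun s => f (x + s * v1) (y + s * v2)) 0 t (fun _ => 0)) as (c & _ & E).
  - intros; apply D.
  - intros s _; apply derivable_continuous_pt; exists 0; now apply is_derive_Reals.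
  - lra.
Qed.

Lemma has_cgrad_const_line f fx fy x y v1 v2 :
  has_cgrad f fx fy ->
  (forall t, fx (x + t * v1)%R (y + t * v2)%R * v1 + fy (x + t * v1)%R (y + t * v2)%R * v2 = 0)%C ->
  forall t, f (x + t * v1) (y + t * v2) = f x y.
Proof.
  intros [H1 H2] Z t; apply C_ext.
  - apply (has_grad_const_line _ _ _ x y v1 v2 H1); intros s.
    generalize (f_equal Re (Z s)).
    unfold Re; simpl; lra.
  - apply (has_grad_const_line _ _ _ x y v1 v2 H2); intros s.
    generalize (f_equal Im (Z s)); unfold Im; simpl; lra.
Qed.

(** * Periodic functions and the theorem of Liouville *)

(** Uniform continuity with [eps = 1]: the segment from the origin to the point is cut into [n]
    steps shorter than [d], and [f] changes by less than 1 on each. *)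
Lemma bounded_on_box f r :
  (forall x y, continuity_2d_pt f x y) -> 0 <= r ->
  exists M, forall x y, Rabs x <= r -> Rabs y <= r -> Rabs (f x y) <= M.
Proof.
  intros Cf Hr.
  destruct (uniform_continuity_2d f (-r) r (-r) r) with (eps := mkposreal 1 Rlt_0_1)
    as (d & Hd); [intros; apply Cf|].
  (* [r + 1] instead of [r] keeps the quotient meaningful for [r = 0] and the step bound strict. *)
  destruct (archimed_cor1 (d / (r + 1))) as (n & Hn & Hn0).
  { apply Rdiv_lt_0_compat; [apply d|lra]. }
  assert (Pn : 0 < INR n) by now apply lt_0_INR.
  assert (Hs : forall z, Rabs z <= r -> Rabs (z / INR n) < d).
  { intros z Hz; unfold Rdiv; rewrite Rabs_mult, (Rabs_pos_eq (/ INR n)).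
    2: now apply Rlt_le, Rinv_0_lt_compat.
    apply Rle_lt_trans with ((r + 1) * / INR n).
    - apply Rmult_le_compat_r; [now apply Rlt_le, Rinv_0_lt_compat|lra].
    - apply (Rmult_lt_compat_l (r + 1)) in Hn; [|lra].
      replace ((r + 1) * (d / (r + 1))) with (d : R) in Hn by (field; lra); lra. }
  exists (Rabs (f 0 0) + INR n); intros x y Hx Hy.
  assert (B : forall z k, Rabs z <= r -> (k <= n)%nat -> - r <= INR k * (z / INR n) <= r).
  { intros z k Hz Hk; apply Rabs_le_between.
    replace (INR k * (z / INR n)) with (z * (INR k / INR n)) by (field; lra).
    rewrite Rabs_mult, (Rabs_pos_eq (INR k / INR n)).
    2: { apply Rmult_le_pos; [apply pos_INR|now apply Rlt_le, Rinv_0_lt_compat]. }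
    apply Rle_trans with (2 := Hz); rewrite <- (Rmult_1_r (Rabs z)) at 2.
    apply Rmult_le_compat_l; [apply Rabs_pos|].
    apply Rle_div_l; [easy|]; rewrite Rmult_1_l; now apply le_INR. }
  assert (S : forall k, (k <= n)%nat ->
    Rabs (f (INR k * (x / INR n)) (INR k * (y / INR n))) <= Rabs (f 0 0) + INR k).
  { induction k as [|k IH]; intros Hk.
    - simpl; rewrite !Rmult_0_l; lra.
    - specialize (IH ltac:(lia)).
      assert (E := Hd (INR k * (x / INR n)) (INR k * (y / INR n))
        (INR (S k) * (x / INR n)) (INR (S k) * (y / INR n))
        (B x k Hx ltac:(lia)) (B y k Hy ltac:(lia)) (B x (S k) Hx Hk) (B y (S k) Hy Hk)).
      simpl (pos _) in E.
      replace (INR (S k) * (x / INR n) - INR k * (x / INR n)) with (x / INR n) in E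
        by (rewrite S_INR; ring).
      replace (INR (S k) * (y / INR n) - INR k * (y / INR n)) with (y / INR n) in E
        by (rewrite S_INR; ring).
      specialize (E (Hs x Hx) (Hs y Hy)).
      pose proof (Rabs_triang_inv (f (INR (S k) * (x / INR n)) (INR (S k) * (y / INR n)))
        (f (INR k * (x / INR n)) (INR k * (y / INR n)))).
      rewrite (S_INR k) at 3; lra. }
  specialize (S n (le_n n)).
  replace (INR n * (x / INR n)) with x in S by (field; lra).
  now replace (INR n * (y / INR n)) with y in S by (field; lra).
Qed.

(** Cramer's rule gives the coordinates [s], [t] in a basis of the lattice; their integer parts form
    the lattice vector and their fractional parts leave a bounded remainder. *)
Lemma lattice_reduction Gamma :
  is_lattice Gamma -> exists r, 0 <= r /\ forall x y, exists x' y' w,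
    Rabs x' <= r /\ Rabs y' <= r /\ Gamma w /\ x = x' + fst w /\ y = y' + snd w.
Proof.
  intros ([u1 u2] & [v1 v2] & Hd & HG); simpl in *.
  set (d := u1 * v2 - u2 * v1) in *.
  exists (Rabs u1 + Rabs u2 + Rabs v1 + Rabs v2); split.
  { pose proof (Rabs_pos u1); pose proof (Rabs_pos u2).
    pose proof (Rabs_pos v1); pose proof (Rabs_pos v2); lra. }
  intros x y.
  set (s := (x * v2 - y * v1) / d); set (t := (u1 * y - u2 * x) / d).
  exists (frac_part s * u1 + frac_part t * v1), (frac_part s * u2 + frac_part t * v2).
  exists (IZR (Int_part s) * u1 + IZR (Int_part t) * v1,
          IZR (Int_part s) * u2 + IZR (Int_part t) * v2).
  assert (B : forall a b, Rabs (frac_part s * a + frac_part t * b) <= Rabs a + Rabs b).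
  { intros a b; eapply Rle_trans; [apply Rabs_triang|].
    rewrite !Rabs_mult.
    destruct (base_fp s), (base_fp t).
    rewrite (Rabs_pos_eq (frac_part s)), (Rabs_pos_eq (frac_part t)) by lra.
    pose proof (Rabs_pos a); pose proof (Rabs_pos b); nra. }
  pose proof (B u1 v1); pose proof (B u2 v2).
  pose proof (Rabs_pos u1); pose proof (Rabs_pos u2).
  pose proof (Rabs_pos v1); pose proof (Rabs_pos v2).
  split; [lra|]; split; [lra|]; split; [apply HG; eauto|]; simpl.
  unfold frac_part; split.
  - transitivity (s * u1 + t * v1); [|ring].
    unfold s, t, d; field; exact Hd.
  - transitivity (s * u2 + t * v2); [|ring].
    unfold s, t, d; field; exact Hd.
Qed.

Lemma periodic_bounded Gamma f :
  is_lattice Gamma -> periodic Gamma f -> (forall x y, continuity_2d_pt f x y) ->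
  exists M, forall x y, Rabs (f x y) <= M.
Proof.
  intros HG Pf Cf.
  destruct (lattice_reduction Gamma HG) as (r & Hr & HR).
  destruct (bounded_on_box f r Cf Hr) as (M & HM).
  exists M; intros x y; destruct (HR x y) as (x' & y' & w & Hx & Hy & Hw & -> & ->).
  rewrite (Pf w Hw); now apply HM.
Qed.

Lemma periodic_max Gamma f :
  is_lattice Gamma -> periodic Gamma f -> (forall x y, continuity_2d_pt f x y) ->
  exists x0 y0, forall x y, f x y <= f x0 y0.
Proof.
  intros HG Pf Cf.
  destruct (periodic_bounded Gamma f HG Pf Cf) as (M & HM).
  destruct (completeness (fun z => exists x y, z = f x y)) as (S & HS1 & HS2).
  { exists M; intros z (x & y & ->); pose proof (HM x y).
    pose proof (Rle_abs (f x y)); lra. }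
  { exists (f 0 0); eauto. }
  assert (HS : forall x y, f x y <= S) by (intros; apply HS1; eauto).
  destruct (Classical_Prop.classic (exists x y, f x y = S)) as [(x0 & y0 & E)|N].
  { exists x0, y0; intros; rewrite E; apply HS. }
  exfalso.
  assert (P : forall x y, S - f x y > 0).
  { intros x y; pose proof (HS x y).
    assert (f x y <> S) by (intros E; apply N; eauto); lra. }
  (* If the supremum [S] is not attained then [1 / (S - f)] is continuous, hence bounded,
     which keeps [f] away from [S]. *)
  destruct (periodic_bounded Gamma (fun x y => / (S - f x y)) HG) as (K & HK).
  - intros w Hw x y; now rewrite (Pf w Hw).
  - intros x y; apply continuity_2d_pt_inv; [|apply Rgt_not_eq, P].
    apply continuity_2d_pt_minus; [apply continuity_2d_pt_const|apply Cf].
  - assert (KP : 0 < K).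
    { pose proof (HK 0 0); pose proof (Rinv_0_lt_compat _ (P 0 0)).
      rewrite Rabs_pos_eq in H; lra. }
    assert (S <= S - / K); [|pose proof (Rinv_0_lt_compat _ KP); lra].
    apply HS2; intros z (x & y & ->).
    pose proof (HK x y) as H; pose proof (Rinv_0_lt_compat _ (P x y)).
    rewrite Rabs_pos_eq in H by lra.
    apply Rinv_le_contravar in H; [|lra].
    rewrite Rinv_inv in H; lra.
Qed.

(** * Mean values over circles and the maximum principle *)

Lemma continuity_2d_pt_comp f g h x y :
  continuity_2d_pt g x y -> continuity_2d_pt h x y ->
  continuity_2d_pt f (g x y) (h x y) ->
  continuity_2d_pt (fun u v => f (g u v) (h u v)) x y.
Proof.
  intros Hg Hh Hf.
  apply continuity_2d_pt_filterlim in Hg.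
  apply continuity_2d_pt_filterlim in Hh.
  apply continuity_2d_pt_filterlim in Hf.
  apply continuity_2d_pt_filterlim.
  apply (continuous_comp_2 (fun z => g (fst z) (snd z)) (fun z => h (fst z) (snd z)) f (x, y));
    assumption.
Qed.

Lemma continuous_of_2d f x y : continuity_2d_pt f x y -> continuous (fun t => f x t) y.
Proof.
  intros H; apply continuity_2d_pt_filterlim in H.
  apply (continuous_comp_2 (fun _ => x) (fun t : R => t) f y).
  - apply continuous_const.
  - apply continuous_id.
  - exact H.
Qed.

(** The integrals over [[a, s]] and [[s, b]] are nonnegative with sum 0, so the primitive of [g]
    vanishes on the whole interval, and so does its derivative [g]. *)
Lemma RInt_0_nonneg_eq_0 g a b t :
  (forall s, continuous g s) -> (forall s, 0 <= g s) -> RInt g a b = 0 -> a < t < b -> g t = 0.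
Proof.
  intros Cg Pg H [Ht1 Ht2].
  assert (X : forall c d, ex_RInt g c d) 
    by (intros; apply (@ex_RInt_continuous R_CompleteNormedModule); intros; apply Cg).
  assert (Z : forall s, a < s < b -> RInt g a s = 0).
  { intros s Hs.
    pose proof (RInt_ge_0 g a s ltac:(lra) (X _ _) (fun x _ => Pg x)).
    pose proof (RInt_ge_0 g s b ltac:(lra) (X _ _) (fun x _ => Pg x)).
    pose proof (@RInt_Chasles R_CompleteNormedModule g a s b (X _ _) (X _ _)) as E.
    rewrite H in E; unfold plus in E; simpl in E; lra. }
  assert (D : is_derive (fun s => RInt g a s) t (g t)).
  { apply (@is_derive_RInt R_NormedModule g (fun s => RInt g a s) a t).
    - apply filter_forall; intros; now apply (@RInt_correct R_CompleteNormedModule).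
    - apply Cg. }
  assert (D0 : is_derive (fun s => RInt g a s) t 0).
  { apply is_derive_ext_loc with (fun _ => 0); [|apply @is_derive_const].
    exists (mkposreal (Rmin (t - a) (b - t)) ltac:(apply Rmin_glb_lt; lra)).
    intros s Hs; symmetry; apply Z.
    apply Rabs_lt_between' in Hs; simpl in Hs.
    pose proof (Rmin_l (t - a) (b - t)); pose proof (Rmin_r (t - a) (b - t)); lra. }
  now rewrite <- (is_derive_unique _ _ _ D), <- (is_derive_unique _ _ _ D0).
Qed.

(** This is [f (z0 + r (a + i b) e^(i t))]. At [r = 1], [t = 0] the point is [z0 + a + i b], so a
    circle around [z0] can be drawn through any prescribed point. *)
Definition circle (f : R -> R -> R) (x0 y0 a b r t : R) : R :=
  f (x0 + r * (a * cos t - b * sin t)) (y0 + r * (a * sin t + b * cos t)).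

Lemma continuity_circle f x0 y0 a b r t :
  (forall x y, continuity_2d_pt f x y) -> continuity_2d_pt (circle f x0 y0 a b) r t.
Proof.
  intros Cf; unfold circle.
  assert (L : forall c d e, continuity_2d_pt (fun u v => c + u * (d * cos v + e * sin v)) r t).
  { intros; apply continuity_2d_pt_plus; [apply continuity_2d_pt_const|].
    apply continuity_2d_pt_mult; [apply continuity_2d_pt_id1|].
    apply continuity_2d_pt_plus; (apply continuity_2d_pt_mult; [apply continuity_2d_pt_const|]).
    - apply continuity_1d_2d_pt_comp; [apply continuity_cos|apply continuity_2d_pt_id2].
    - apply continuity_1d_2d_pt_comp; [apply continuity_sin|apply continuity_2d_pt_id2]. }
  apply continuity_2d_pt_comp; [| |apply Cf].
  - apply continuity_2d_pt_ext with (2 := L x0 a (- b)); intros; ring.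
  - apply continuity_2d_pt_ext with (2 := L y0 b a); intros; ring.
Qed.

Lemma is_derive_circle_radius f fx fy x0 y0 a b r t :
  has_grad f fx fy ->
  is_derive (fun s => circle f x0 y0 a b s t) r
    (circle fx x0 y0 a b r t * (a * cos t - b * sin t) +
     circle fy x0 y0 a b r t * (a * sin t + b * cos t)).
Proof.
  intros H; apply (is_derive_curve f fx fy (fun s => x0 + s * (a * cos t - b * sin t))
    (fun s => y0 + s * (a * sin t + b * cos t)) r _ _ H); auto_derive; trivial; ring.
Qed.

Lemma is_derive_circle_angle f fx fy x0 y0 a b r t :
  has_grad f fx fy ->
  is_derive (circle f x0 y0 a b r) t
    (circle fx x0 y0 a b r t * (r * (- a * sin t - b * cos t)) +
     circle fy x0 y0 a b r t * (r * (a * cos t - b * sin t))).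
Proof.
  intros H; apply (is_derive_curve f fx fy (fun s => x0 + r * (a * cos s - b * sin s))
    (fun s => y0 + r * (a * sin s + b * cos s)) t _ _ H); auto_derive; trivial; ring.
Qed.

Section Conjugate.

Context (u ux uy v vx vy : R -> R -> R).
Context (Hu : has_grad u ux uy) (Hv : has_grad v vx vy).
(** These are the Cauchy-Riemann equations with reversed sign: [u + i v] is antiholomorphic. A
    conjugate pair gives the mean value property from first derivatives only, whereas the Laplacian
    would need second ones. *)
Context (CR1 : forall x y, ux x y = - vy x y) (CR2 : forall x y, uy x y = vx x y).

Lemma circle_mean x0 y0 a b :
  RInt (circle u x0 y0 a b 1) (- PI) PI = 2 * PI * u x0 y0.
Proof.
  pose proof Hu as (_ & _ & Cx & Cy).
  set (D := fun r t => circle ux x0 y0 a b r t * (a * cos t - b * sin t) +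
     circle uy x0 y0 a b r t * (a * sin t + b * cos t)).
  assert (DE : forall r t, Derive (fun s => circle u x0 y0 a b s t) r = D r t).
  { intros; apply is_derive_unique; now apply is_derive_circle_radius. }
  assert (CD : forall r t, continuity_2d_pt D r t).
  { intros r t; unfold D.
    apply continuity_2d_pt_plus; apply continuity_2d_pt_mult; try now apply continuity_circle.
    - apply continuity_2d_pt_ext with (fun _ v => cos v * a - sin v * b); [intros; ring|].
      apply (continuity_1d_2d_pt_comp (fun v => cos v * a - sin v * b)); [|apply continuity_2d_pt_id2].
      reg.
    - apply continuity_2d_pt_ext with (fun _ v => sin v * a + cos v * b); [intros; ring|].
      apply (continuity_1d_2d_pt_comp (fun v => sin v * a + cos v * b)); [|apply continuity_2d_pt_id2].
      reg. }
  assert (DM : forall r, is_derive (fun r => RInt (circle u x0 y0 a b r) (- PI) PI) r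
                (RInt (D r) (- PI) PI)).
  { intros r.
    rewrite (RInt_ext (D r) (fun t => Derive (fun s => circle u x0 y0 a b s t) r))
      by (intros; now rewrite DE).
    apply (is_derive_RInt_param (circle u x0 y0 a b)).
    - apply filter_forall; intros s t _; eexists; now apply is_derive_circle_radius with (1 := Hu).
    - intros t _; apply continuity_2d_pt_ext with D; [intros; now rewrite DE|apply CD].
    - apply filter_forall; intros s.
      apply (@ex_RInt_continuous R_CompleteNormedModule); intros t _.
      apply continuous_of_2d, continuity_circle; intros; eapply has_grad_continuity; exact Hu. }
  (* By the Cauchy-Riemann equations [D r = - (1 / r) d/dt (circle v r)]. *)
  assert (Z : forall r, 0 < r -> RInt (D r) (- PI) PI = 0).
  { intros r Hr; apply is_RInt_unique.
    replace 0 with (minus (- / r * circle v x0 y0 a b r PI) (- / r * circle v x0 y0 a b r (- PI))).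
    2: { unfold minus, plus, opp, circle; simpl.
         rewrite cos_neg, sin_neg, sin_PI, Ropp_0; ring. }
    apply (@is_RInt_derive R_CompleteNormedModule (fun t => - / r * circle v x0 y0 a b r t)).
    - intros t _; unfold D.
      assert (E : circle ux x0 y0 a b r t = - circle vy x0 y0 a b r t) by apply CR1.
      assert (E' : circle uy x0 y0 a b r t = circle vx x0 y0 a b r t) by apply CR2.
      rewrite E, E'.
      eapply (eq_rect _ (fun l => is_derive _ t l));
        [apply (is_derive_scal (circle v x0 y0 a b r) t (- / r)), is_derive_circle_angle, Hv|].
      simpl; field; lra.
    - intros t _; apply continuous_of_2d, CD. }
  (* The factor [1 / r] forbids [r = 0], but the mean value theorem on [[0, 1]] evaluates the
     derivative only at an interior point. *)
  destruct (MVT_cor2 (fun r => RInt (circle u x0 y0 a b r) (- PI) PI)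
    (fun r => RInt (D r) (- PI) PI) 0 1 Rlt_0_1) as (c & Hc & Hc').
  { intros c _; apply is_derive_Reals, DM. }
  rewrite (Z c) in Hc by apply Hc'.
  assert (E : RInt (circle u x0 y0 a b 0) (- PI) PI = 2 * PI * u x0 y0).
  { rewrite (RInt_ext _ (fun _ => u x0 y0)).
    - rewrite RInt_const; unfold scal; simpl; unfold mult; simpl; ring.
    - intros t _; unfold circle; f_equal; ring. }
  lra.
Qed.

(** The mean of [u] over the circle around a maximum through a given point equals the maximum, so
    [u] equals it all along that circle. One circle per point suffices; no connectedness argument
    occurs. *)
Lemma conjugate_liouville Gamma :
  is_lattice Gamma -> periodic Gamma u -> forall x y, u x y = u 0 0.
Proof.
  intros HG Pu.
  assert (Cu : forall x y, continuity_2d_pt u x y)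
    by (intros; eapply has_grad_continuity; exact Hu).
  destruct (periodic_max Gamma u HG Pu Cu) as (x0 & y0 & M).
  assert (E : forall x y, u x y = u x0 y0); [|intros; now rewrite (E x y), (E 0 0)].
  intros x y; pose proof PI_RGT_0.
  set (g := circle u x0 y0 (x - x0) (y - y0) 1).
  assert (Cg : forall t, continuous g t) by (intros; now apply continuous_of_2d, continuity_circle).
  assert (X : ex_RInt g (- PI) PI)
    by (apply (@ex_RInt_continuous R_CompleteNormedModule); intros; apply Cg).
  assert (Z : u x0 y0 - g 0 = 0).
  { apply (RInt_0_nonneg_eq_0 (fun t => u x0 y0 - g t) (- PI) PI); [| | |lra].
    - intros s; apply (@continuous_minus _ R_AbsRing R_NormedModule);
        [apply continuous_const|apply Cg].
    - intros s; unfold g, circle.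
      pose proof (M (x0 + 1 * ((x - x0) * cos s - (y - y0) * sin s))
                    (y0 + 1 * ((x - x0) * sin s + (y - y0) * cos s))); lra.
    - transitivity (minus (RInt (fun _ => u x0 y0) (- PI) PI) (RInt g (- PI) PI)).
      + apply (@RInt_minus R_CompleteNormedModule); [apply @ex_RInt_const|exact X].
      + rewrite RInt_const; unfold g; rewrite circle_mean.
        unfold minus, plus, opp, scal; simpl; unfold mult; simpl; ring. }
  unfold g, circle in Z; rewrite cos_0, sin_0 in Z.
  replace (x0 + 1 * ((x - x0) * 1 - (y - y0) * 0)) with x in Z by ring.
  replace (y0 + 1 * ((x - x0) * 0 + (y - y0) * 1)) with y in Z by ring.
  lra.
Qed.

End Conjugate.

Definition cperiodic (Gamma : R * R -> Prop) (f : R -> R -> C) : Prop :=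
  forall w : R * R, Gamma w -> forall x y : R, f (x + fst w) (y + snd w) = f x y.

Lemma antiholomorphic_liouville Gamma f fx fy :
  is_lattice Gamma -> cperiodic Gamma f -> has_cgrad f fx fy ->
  (forall x y, fx x y - Ci * fy x y = 0)%C -> forall x y, f x y = f 0 0.
Proof.
  intros HG Pf [H1 H2] Z x y; apply C_ext.
  - apply (conjugate_liouville _ _ _ _ _ _ H1 H2) with (Gamma := Gamma); trivial.
    + intros s t; generalize (f_equal Re (Z s t)); unfold Re, Im; simpl; lra.
    + intros s t; generalize (f_equal Im (Z s t)); unfold Re, Im; simpl; lra.
    + intros w Hw s t; now rewrite (Pf w Hw).
  (* [- i f] is antiholomorphic too, with real part [Im f] and imaginary part [- Re f]. *)
  - apply (conjugate_liouville _ _ _ _ _ _ H2 (has_grad_opp _ _ _ H1)) with (Gamma := Gamma);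
      trivial.
    + intros s t; generalize (f_equal Im (Z s t)); unfold Re, Im; simpl; lra.
    + intros s t; generalize (f_equal Re (Z s t)); unfold Re, Im; simpl; lra.
    + intros w Hw s t; now rewrite (Pf w Hw).
Qed.

(** * The chain of coefficients *)

Lemma has_cgrad_zero_grad f fx fy :
  has_cgrad f fx fy -> (forall x y, f x y = f 0 0) ->
  forall x y, fx x y = 0 /\ fy x y = 0.
Proof.
  intros H E x y; apply (has_cgrad_locally_const f fx fy x y (f 0 0) H).
  apply locally_2d_forall; intros; apply E.
Qed.

Lemma RtoC_fact_neq_0 n : RtoC (INR (fact n)) <> 0.
Proof. intros E; apply (INR_fact_neq_0 n), (f_equal Re E). Qed.

(* The chain [d E_(i+1) = Omega E_i] determines [E_(i+1)] up to a constant; subtracting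
   [c h^i / i!], where [c = E_0], shortens the chain by one. *)
Lemma holomorphic_chain Gamma (h hx hy : R -> R -> C) (W : R -> R -> C) k :
  is_lattice Gamma -> has_cgrad h hx hy -> cperiodic Gamma h ->
  (forall x y, hx x y - Ci * hy x y = W x y)%C ->
  forall E Ex Ey : nat -> R -> R -> C,
  (forall i, (i <= k)%nat -> has_cgrad (E i) (Ex i) (Ey i) /\ cperiodic Gamma (E i)) ->
  (forall x y, Ex 0%nat x y - Ci * Ey 0%nat x y = 0)%C ->
  (forall i x y, (i < k)%nat -> Ex (S i) x y - Ci * Ey (S i) x y = W x y * E i x y)%C ->
  forall i x y, (i < k)%nat ->
    (Ex (S i) x y = E i x y * hx x y /\ Ey (S i) x y = E i x y * hy x y)%C.
Proof.
  intros HG Hh Ph Wh; induction k as [|k IH]; [lia|].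
  intros E Ex Ey HE E0 ES.
  destruct (HE 0%nat ltac:(lia)) as [G0 P0].
  pose proof (antiholomorphic_liouville Gamma _ _ _ HG P0 G0 E0) as K0.
  set (c := E 0%nat 0 0) in *.
  set (cf := fun i => (c / INR (fact (S i)))%C).
  set (F := fun i x y => (E (S i) x y - cf i * h x y ^ S i)%C).
  set (Fx := fun i x y => (Ex (S i) x y - cf i * (INR (S i) * h x y ^ i * hx x y))%C).
  set (Fy := fun i x y => (Ey (S i) x y - cf i * (INR (S i) * h x y ^ i * hy x y))%C).
  assert (HF : forall i, (i <= k)%nat -> has_cgrad (F i) (Fx i) (Fy i) /\ cperiodic Gamma (F i)).
  { intros i Hi; destruct (HE (S i) ltac:(lia)) as [G P]; split.
    - apply has_cgrad_minus; [exact G|].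
      apply has_cgrad_scal, (has_cgrad_pow (S i)), Hh.
    - intros w Hw x y; unfold F; now rewrite (P w Hw), (Ph w Hw). }
  assert (cfS : forall i, (cf (S i) * INR (S (S i)) = cf i)%C).
  { intros i; unfold cf; rewrite (fact_simpl (S i)), mult_INR, RtoC_mult.
    field; split; [apply RtoC_fact_neq_0|].
    intros X; apply (not_0_INR (S (S i))); [lia|]; exact (f_equal Re X). }
  assert (F0 : forall x y, (Fx 0%nat x y - Ci * Fy 0%nat x y = 0)%C).
  { intros x y; unfold Fx, Fy.
    transitivity ((Ex 1%nat x y - Ci * Ey 1%nat x y) - cf 0%nat * (hx x y - Ci * hy x y))%C.
    - simpl; ring.
    - rewrite ES, Wh, K0 by lia; unfold cf; simpl; field; apply C1_nz. }
  assert (FS : forall i x y, (i < k)%nat ->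
    (Fx (S i) x y - Ci * Fy (S i) x y = W x y * F i x y)%C).
  { intros i x y Hi; unfold Fx, Fy, F.
    transitivity ((Ex (S (S i)) x y - Ci * Ey (S (S i)) x y)
      - (cf (S i) * INR (S (S i))) * h x y ^ S i * (hx x y - Ci * hy x y))%C; [ring|].
    rewrite ES, Wh, cfS by lia; ring. }
  specialize (IH F Fx Fy HF F0 FS).
  intros [|i] x y Hi.
  (* The first shortened term [E 1 - c h] is antiholomorphic, hence constant, so the gradient of
     [E 1] is [c] times that of [h]. *)
  - destruct (HF 0%nat ltac:(lia)) as [G P].
    pose proof (antiholomorphic_liouville Gamma _ _ _ HG P G F0) as K1.
    destruct (has_cgrad_zero_grad _ _ _ G K1 x y) as [Zx Zy].
    unfold Fx, Fy, cf in Zx, Zy; simpl in Zx, Zy; rewrite K0; split.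
    + apply Ceq_minus; rewrite <- Zx; field; apply C1_nz.
    + apply Ceq_minus; rewrite <- Zy; field; apply C1_nz.
  - destruct (IH i x y ltac:(lia)) as [Zx Zy]; unfold Fx, Fy, F in Zx, Zy.
    apply Ceq_minus in Zx; apply Ceq_minus in Zy; split; apply Ceq_minus.
    + rewrite <- Zx, <- (cfS i); ring.
    + rewrite <- Zy, <- (cfS i); ring.
Qed.

(** [Y t * exp (- K t)] does not increase on [[0, 1]] and starts at 0. The bound is asked for on
    [[0, 1]] only, since [K] will come from a compact box. *)
Lemma gronwall_zero Y dY K :
  (forall t, is_derive Y t (dY t)) -> (forall t, 0 <= Y t) -> Y 0 = 0 ->
  (forall t, 0 <= t <= 1 -> dY t <= K * Y t) -> Y 1 = 0.
Proof.
  intros D P Z B.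
  destruct (MVT_cor2 (fun t => Y t * exp (- K * t))
    (fun t => (dY t - K * Y t) * exp (- K * t)) 0 1 Rlt_0_1) as (c & Hc & Hc').
  { intros t _; apply is_derive_Reals.
    assert (ex_derive Y t) by (eexists; apply D).
    auto_derive; [easy|].
    assert (EY : Derive (fun s : R => Y s) t = dY t) by (apply is_derive_unique, D).
    rewrite EY; ring. }
  rewrite Z in Hc.
  pose proof (exp_pos (- K * c)); pose proof (exp_pos (- K * 1)).
  pose proof (B c ltac:(lra)); pose proof (P 1).
  nra.
Qed.

Lemma proportional_points x1 y1 x2 y2 a1 b1 a2 b2 :
  a1 * b2 - b1 * a2 <> 0 -> exists s t,
    x1 + s * a1 = x2 + t * a2 /\ y1 + s * b1 = y2 + t * b2.
Proof.
  intros D.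
  exists (((x2 - x1) * b2 - (y2 - y1) * a2) / (a1 * b2 - b1 * a2)),
    (((x2 - x1) * b1 - (y2 - y1) * a1) / (a1 * b2 - b1 * a2)).
  split; field; exact D.
Qed.

(** * One row as an abstract chain of functions on the torus *)

Section Chain.

Context (Gamma : R * R -> Prop) (HG : is_lattice Gamma).
Context (Lambda Lx Ly Omega : R -> R -> R).
Context (HL : has_grad Lambda Lx Ly).
Context (Lpos : forall x y, 0 < Lambda x y).
Context (COmega : forall x y, continuity_2d_pt Omega x y).
Context (NOmega : exists x y, Omega x y <> 0).
(** [e m] stands for [i^m m! g_m], and [ex m - Ci * ey m] is [2 d e_m], whence the factor 2 in
    [chain]. [divergence] is the equation of weight zero. *)
Context (e ex ey : nat -> R -> R -> C) (M : nat).
Context (He : forall m, has_cgrad (e m) (ex m) (ey m)).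
Context (Pe : forall m, cperiodic Gamma (e m)).
Context (M1 : (1 <= M)%nat).
Context (top : exists x y, e M x y <> 0).
Context (above : forall m x y, (M < m)%nat -> e m x y = 0).
Context (chain : forall m x y,
  (ex m x y - Ci * ey m x y = RtoC (2 * Omega x y)%R * e (S m) x y)%C).
Context (real0 : forall x y, Im (e 0%nat x y) = 0).
Context (divergence : forall x y,
  Lx x y * Im (e 1%nat x y) + Ly x y * Re (e 1%nat x y) +
  Lambda x y * (Im (ex 1%nat x y) + Re (ey 1%nat x y)) = 0).
(** The trace that analyticity leaves here: [e 1] contains a power of [Lambda], which is merely
    smooth, so [e 1] itself cannot be assumed analytic. *)
Context (continuation : forall x y,
  locally_2d (fun u v => e 1%nat u v = 0) x y -> forall u v, e 1%nat u v = 0).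

Let A x y := Re (e 1%nat x y).
Let B x y := Im (e 1%nat x y).

Lemma top_const x y : e M x y = e M 0 0.
Proof.
  apply (antiholomorphic_liouville Gamma _ _ _ HG (Pe M) (He M)).
  intros u v; rewrite chain, above by lia; ring.
Qed.

Lemma top_neq_0 : e M 0 0 <> 0.
Proof. destruct top as (x & y & H); now rewrite top_const in H. Qed.

Let h x y := (/ e M 0 0 * e (M - 1)%nat x y)%C.
Let hx x y := (/ e M 0 0 * ex (M - 1)%nat x y)%C.
Let hy x y := (/ e M 0 0 * ey (M - 1)%nat x y)%C.

Lemma has_cgrad_h : has_cgrad h hx hy.
Proof. apply has_cgrad_scal, He. Qed.

Lemma cperiodic_h : cperiodic Gamma h.
Proof. intros w Hw x y; unfold h; now rewrite (Pe _ w Hw). Qed.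

Lemma d_h x y : (hx x y - Ci * hy x y = RtoC (2 * Omega x y)%R)%C.
Proof.
  unfold hx, hy.
  transitivity (/ e M 0 0 * (ex (M - 1)%nat x y - Ci * ey (M - 1)%nat x y))%C; [ring|].
  rewrite chain; replace (S (M - 1)) with M by lia; rewrite (top_const x y).
  field; apply top_neq_0.
Qed.

(** This is [e_m' = e_(m+1)], the prime denoting differentiation with respect to [h]. *)
Lemma grad_e m x y :
  (ex m x y = e (S m) x y * hx x y /\ ey m x y = e (S m) x y * hy x y)%C.
Proof.
  destruct (le_lt_dec M m) as [Hm|Hm].
  - rewrite (above (S m)) by lia.
    destruct (has_cgrad_zero_grad _ _ _ (He m)) with (x := x) (y := y) as [-> ->].
    + intros u v; destruct (Nat.eq_dec m M) as [->|].
      * apply top_const.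
      * now rewrite !above by lia.
    + split; ring.
  (* [holomorphic_chain] starts from the constant term, so the chain is run downwards from [M]. *)
  - destruct (holomorphic_chain Gamma h hx hy (fun x y => RtoC (2 * Omega x y)) M HG
      has_cgrad_h cperiodic_h d_h (fun i => e (M - i)%nat) (fun i => ex (M - i)%nat)
      (fun i => ey (M - i)%nat)) with (i := (M - S m)%nat) (x := x) (y := y) as [Zx Zy].
    + intros i _; split; [apply He|apply Pe].
    + intros u v; rewrite Nat.sub_0_r, chain, above by lia; ring.
    + intros i u v Hi; rewrite chain; now replace (S (M - S i)) with (M - i)%nat by lia.
    + lia.
    + replace (M - S (M - S m))%nat with m in Zx, Zy by lia.
      replace (M - (M - S m))%nat with (S m) in Zx, Zy by lia.
      now split.
Qed.

(** If [e 1] vanished, then on the open set [Omega <> 0] the chain would make [e 2], [e 3], ...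
    vanish one after the other, up to the nonzero constant [e M]. *)
Lemma e1_not_zero : exists x y, e 1%nat x y <> 0.
Proof.
  apply Classical_Prop.NNPP; intros N.
  assert (Z1 : forall x y, e 1%nat x y = 0).
  { intros x y; apply Classical_Prop.NNPP; intros H; eauto. }
  assert (Z : forall m x y, Omega x y <> 0 -> e (S m) x y = 0).
  { induction m as [|m IH]; [intros; apply Z1|]; intros x y HO.
    destruct (has_cgrad_locally_const _ _ _ x y 0 (He (S m))) as [Zx Zy].
    - apply locally_2d_impl with (2 := continuity_2d_pt_neq_0 _ x y (COmega x y) HO).
      apply locally_2d_forall; apply IH.
    - generalize (chain (S m) x y); rewrite Zx, Zy; intros X.
      apply Classical_Prop.NNPP; intros H.
      apply (Cmult_neq_0 (RtoC (2 * Omega x y)) (e (S (S m)) x y)); [|exact H|].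
      + intros Y; apply (f_equal Re) in Y; simpl in Y; lra.
      + rewrite <- X; ring. }
  destruct NOmega as (x & y & HO).
  apply top_neq_0; rewrite <- (top_const x y).
  replace M with (S (M - 1)) by lia; now apply Z.
Qed.

(** A continuous [D] that is nonzero at a point is nonzero nearby; there [e 1] would vanish, and by
    [continuation] everywhere. *)
Lemma dense_zero D :
  (forall x y, continuity_2d_pt D x y) -> (forall x y, e 1%nat x y <> 0 -> D x y = 0) ->
  forall x y, D x y = 0.
Proof.
  intros CD Z x y; apply Classical_Prop.NNPP; intros N.
  destruct e1_not_zero as (u & v & H); apply H; apply (continuation x y).
  apply locally_2d_impl with (2 := continuity_2d_pt_neq_0 _ x y (CD x y) N).
  apply locally_2d_forall; intros s t Hst.
  apply Classical_Prop.NNPP; intros X; apply Hst, Z, X.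
Qed.

(* [e 0] is real with derivative [e 1] as a function of [h]. *)
Lemma h_transport x y : (hx x y * B x y + hy x y * A x y = 0)%C.
Proof.
  destruct (grad_e 0 x y) as [Ex Ey].
  pose proof (d_h x y) as D.
  assert (R0 : Im (ex 0%nat x y) = 0 /\ Im (ey 0%nat x y) = 0).
  { destruct (He 0) as [_ H2].
    destruct (has_grad_unique _ _ _ _ _ x y H2 (has_grad_ext _ _ _ _ _ _
      (fun u v => eq_sym (real0 u v)) (fun _ _ => eq_refl) (fun _ _ => eq_refl)
      (has_grad_const 0))); auto. }
  destruct R0 as [Rx Ry]; rewrite Ex in Rx; rewrite Ey in Ry.
  unfold A, B; revert D Rx Ry; generalize (Omega x y), (e 1%nat x y), (hx x y), (hy x y).
  intros O [a b] [p q] [r s] D Rx Ry; unfold Re, Im in *; simpl in *.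
  injection D; intros D2 D1.
  (* [Omega] is real, hence [Im hx = Re hy]. With this symmetry the equations [Im (e_1 hx) = 0] and
     [Im (e_1 hy) = 0] become the real and imaginary parts of the claim. *)
  assert (r = q) by lra; subst r.
  apply C_ext; unfold Re, Im; simpl; ring_simplify; lra.
Qed.

Lemma e1_transport x y :
  (ex 1%nat x y * B x y + ey 1%nat x y * A x y = 0)%C.
Proof.
  destruct (grad_e 1 x y) as [-> ->].
  transitivity (e 2%nat x y * (hx x y * B x y + hy x y * A x y))%C; [ring|].
  rewrite h_transport; ring.
Qed.

(** No differential equation is solved. Follow the straight line whose direction is frozen at its
    start, and let [a], [b] be the changes of [A], [B] along it. The transport equation at the
    moving point differs from the derivative along the line only by terms linear in [a], [b]; these
    start at 0, so Gronwall keeps them 0. Putting [T] into the direction reduces both signs of time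
    to [[0, 1]]. *)
Lemma e1_characteristic x y T : e 1%nat (x + T * B x y) (y + T * A x y) = e 1%nat x y.
Proof.
  destruct (He 1%nat) as [HA HB].
  set (a := fun t => A (x + t * (T * B x y)) (y + t * (T * A x y)) - A x y).
  set (b := fun t => B (x + t * (T * B x y)) (y + t * (T * A x y)) - B x y).
  set (P := fun t => ex 1%nat (x + t * (T * B x y)) (y + t * (T * A x y))).
  set (Q := fun t => ey 1%nat (x + t * (T * B x y)) (y + t * (T * A x y))).
  assert (TR : forall t, Re (P t) * B x y + Re (Q t) * A x y = - (Re (P t) * b t + Re (Q t) * a t)
    /\ Im (P t) * B x y + Im (Q t) * A x y = - (Im (P t) * b t + Im (Q t) * a t)).
  { intros t.
    generalize (e1_transport (x + t * (T * B x y)) (y + t * (T * A x y))).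
    fold (P t) (Q t); intros X; unfold a, b.
    generalize (f_equal Re X) (f_equal Im X).
    destruct (P t), (Q t); unfold Re, Im; simpl; intros; split; lra. }
  assert (Da : forall t, is_derive a t (- T * (Re (P t) * b t + Re (Q t) * a t))).
  { intros t.
    replace (- T * (Re (P t) * b t + Re (Q t) * a t))
      with (minus (Re (P t) * (T * B x y) + Re (Q t) * (T * A x y)) 0).
    2: { unfold minus, plus, opp; simpl; destruct (TR t) as [X _].
         replace (- T * (Re (P t) * b t + Re (Q t) * a t))
           with (T * - (Re (P t) * b t + Re (Q t) * a t)) by ring.
         rewrite <- X; ring. }
    apply (@is_derive_minus R_AbsRing R_NormedModule); [|apply @is_derive_const].
    apply (is_derive_line A _ _ x y (T * B x y) (T * A x y) t HA). }
  assert (Db : forall t, is_derive b t (- T * (Im (P t) * b t + Im (Q t) * a t))).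
  { intros t.
    replace (- T * (Im (P t) * b t + Im (Q t) * a t))
      with (minus (Im (P t) * (T * B x y) + Im (Q t) * (T * A x y)) 0).
    2: { unfold minus, plus, opp; simpl; destruct (TR t) as [_ X].
         replace (- T * (Im (P t) * b t + Im (Q t) * a t))
           with (T * - (Im (P t) * b t + Im (Q t) * a t)) by ring.
         rewrite <- X; ring. }
    apply (@is_derive_minus R_AbsRing R_NormedModule); [|apply @is_derive_const].
    apply (is_derive_line B _ _ x y (T * B x y) (T * A x y) t HB). }
  (* A box containing the whole segment, on which the first derivatives of [e 1] are bounded. *)
  set (r := Rabs x + Rabs y + Rabs (T * B x y) + Rabs (T * A x y)).
  assert (Hr : 0 <= r /\ forall t, 0 <= t <= 1 ->
    Rabs (x + t * (T * B x y)) <= r /\ Rabs (y + t * (T * A x y)) <= r).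
  { pose proof (Rabs_pos x); pose proof (Rabs_pos y).
    pose proof (Rabs_pos (T * B x y)); pose proof (Rabs_pos (T * A x y)).
    split; [unfold r; lra|]; intros t Ht.
    pose proof (Rabs_triang x (t * (T * B x y))) as X1.
    pose proof (Rabs_triang y (t * (T * A x y))) as X2.
    rewrite (Rabs_mult t), (Rabs_pos_eq t) in X1, X2 by lra.
    unfold r; split; nra. }
  destruct Hr as [Hr0 Hr].
  destruct HA as (_ & _ & C1 & C2), HB as (_ & _ & C3 & C4).
  destruct (bounded_on_box _ r C1 Hr0) as (K1 & HK1).
  destruct (bounded_on_box _ r C2 Hr0) as (K2 & HK2).
  destruct (bounded_on_box _ r C3 Hr0) as (K3 & HK3).
  destruct (bounded_on_box _ r C4 Hr0) as (K4 & HK4).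
  assert (Y1 : a 1 * a 1 + b 1 * b 1 = 0).
  { apply (gronwall_zero (fun t => a t * a t + b t * b t)
      (fun t => 2 * (- T * (Re (P t) * b t + Re (Q t) * a t)) * a t
              + 2 * (- T * (Im (P t) * b t + Im (Q t) * a t)) * b t)
      (Rabs T * (4 * (K1 + K2 + K3 + K4)))).
    - intros t; auto_derive.
      + assert (ex_derive a t) by (eexists; apply Da).
        assert (ex_derive b t) by (eexists; apply Db).
        easy.
      + pose proof (is_derive_unique _ _ _ (Da t)) as Ea.
        pose proof (is_derive_unique _ _ _ (Db t)) as Eb.
        change (Derive (fun s : R => a s) t = - T * (Re (P t) * b t + Re (Q t) * a t)) in Ea.
        change (Derive (fun s : R => b s) t = - T * (Im (P t) * b t + Im (Q t) * a t)) in Eb.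
        rewrite Ea, Eb; ring.
    - intros t; nra.
    - unfold a, b; rewrite !Rmult_0_l, !Rplus_0_r, (Rminus_diag_eq (A x y) _ eq_refl),
        (Rminus_diag_eq (B x y) _ eq_refl), Rmult_0_l; apply Rplus_0_l.
    - intros t Ht; destruct (Hr t Ht) as [Hx Hy].
      specialize (HK1 _ _ Hx Hy); specialize (HK2 _ _ Hx Hy).
      specialize (HK3 _ _ Hx Hy); specialize (HK4 _ _ Hx Hy).
      fold (P t) in HK1, HK3; fold (Q t) in HK2, HK4.
      assert (G : forall k K u v, Rabs k <= K -> Rabs (k * (u * v)) <= K * (u * u + v * v)).
      { intros k K u v Hk; rewrite Rabs_mult.
        pose proof (Rabs_pos k).
        apply Rmult_le_compat; try apply Rabs_pos; [exact Hk|].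
        apply Rabs_le; split; nra. }
      pose proof (G _ _ (b t) (a t) HK1) as G1; pose proof (G _ _ (a t) (a t) HK2) as G2.
      pose proof (G _ _ (b t) (b t) HK3) as G3; pose proof (G _ _ (a t) (b t) HK4) as G4.
      set (Z := Re (P t) * (b t * a t) + Re (Q t) * (a t * a t)
              + Im (P t) * (b t * b t) + Im (Q t) * (a t * b t)).
      replace (2 * (- T * (Re (P t) * b t + Re (Q t) * a t)) * a t
              + 2 * (- T * (Im (P t) * b t + Im (Q t) * a t)) * b t)
        with (- (T * (2 * Z))) by (unfold Z; ring).
      rewrite Rmult_assoc.
      apply Rle_trans with (Rabs T * (2 * Rabs Z)).
      + rewrite <- (Rabs_pos_eq 2) at 2 by lra.
        rewrite <- !Rabs_mult, <- Rabs_Ropp; apply Rle_abs.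
      + apply Rmult_le_compat_l; [apply Rabs_pos|].
        assert (Rabs Z <= (K1 + K2 + K3 + K4) * (2 * (a t * a t + b t * b t))).
        { assert (0 <= K1 /\ 0 <= K2 /\ 0 <= K3 /\ 0 <= K4).
          { repeat split; (eapply Rle_trans; [apply Rabs_pos|eassumption]). }
          pose proof (Rabs_triang (Re (P t) * (b t * a t) + Re (Q t) * (a t * a t)
              + Im (P t) * (b t * b t)) (Im (Q t) * (a t * b t))).
          pose proof (Rabs_triang (Re (P t) * (b t * a t) + Re (Q t) * (a t * a t))
              (Im (P t) * (b t * b t))).
          pose proof (Rabs_triang (Re (P t) * (b t * a t)) (Re (Q t) * (a t * a t))).
          fold Z in H0.
          pose proof (Rle_0_sqr (a t)); pose proof (Rle_0_sqr (b t)); unfold Rsqr in *.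
          nra. }
        lra. }
  assert (a 1 = 0 /\ b 1 = 0) as [a1 b1] by (split; nra).
  unfold a, b, A, B in a1, b1; rewrite Rmult_1_l in a1, b1; rewrite Rmult_1_l in a1, b1.
  apply C_ext; unfold A, B; lra.
Qed.

Lemma e1_parallel x y x' y' : A x y * B x' y' = B x y * A x' y'.
Proof.
  destruct (Req_dec (B x y * A x' y' - A x y * B x' y') 0) as [|N]; [lra|].
  destruct (proportional_points x y x' y' (B x y) (A x y) (B x' y') (A x' y') N)
    as (s & t & E1 & E2).
  pose proof (e1_characteristic x y s) as H; pose proof (e1_characteristic x' y' t) as H'.
  rewrite E1, E2, H' in H; unfold A, B; rewrite H; ring.
Qed.

(** [v] is the value of [V = (B, A)] at one point where [e 1 <> 0]. At every other such point [V] is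
    a nonzero multiple of [v], so an equation along [V] is one along [v] ([along]), and density does
    the rest. *)
Lemma invariant_direction : exists v1 v2 : R, (v1 <> 0 \/ v2 <> 0) /\
  (forall x y, hx x y * v1 + hy x y * v2 = 0)%C /\
  (forall x y, Lx x y * v1 + Ly x y * v2 = 0).
Proof.
  destruct e1_not_zero as (x0 & y0 & N).
  set (v1 := B x0 y0); set (v2 := A x0 y0).
  assert (NZ : forall x y, e 1%nat x y <> 0 -> A x y <> 0 \/ B x y <> 0).
  { intros x y H; destruct (Req_dec (A x y) 0); [|now left].
    right; intros Z; apply H, C_ext; assumption. }
  assert (par : forall x y, A x y * v1 = B x y * v2) by (intros; apply e1_parallel).
  assert (along : forall p q x y, e 1%nat x y <> 0 ->
    p * B x y + q * A x y = 0 -> p * v1 + q * v2 = 0).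
  { intros p q x y H Z; pose proof (par x y) as P.
    assert (ZA : A x y * (p * v1 + q * v2) = 0).
    { transitivity (v2 * (p * B x y + q * A x y)); [|rewrite Z; ring].
      transitivity (p * (A x y * v1) + q * v2 * A x y); [ring|rewrite P; ring]. }
    assert (ZB : B x y * (p * v1 + q * v2) = 0).
    { transitivity (v1 * (p * B x y + q * A x y)); [|rewrite Z; ring].
      transitivity (q * (B x y * v2) + p * v1 * B x y); [ring|rewrite <- P; ring]. }
    destruct (NZ x y H) as [X|X].
    - apply Rmult_integral in ZA; tauto.
    - apply Rmult_integral in ZB; tauto. }
  destruct has_cgrad_h as [(_ & _ & C1 & C2) (_ & _ & C3 & C4)].
  destruct HL as (_ & _ & C5 & C6).
  assert (CC : forall f g : R -> R -> R, (forall x y, continuity_2d_pt f x y) ->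
    (forall x y, continuity_2d_pt g x y) ->
    forall x y, continuity_2d_pt (fun u v => f u v * v1 + g u v * v2) x y).
  { intros f g Cf Cg x y; apply continuity_2d_pt_plus; apply continuity_2d_pt_mult;
      auto; apply continuity_2d_pt_const. }
  exists v1, v2; split; [destruct (NZ x0 y0 N); unfold v1, v2; tauto|]; split.
  - intros x y; apply C_ext.
    + transitivity (Re (hx x y) * v1 + Re (hy x y) * v2); [unfold Re; simpl; ring|].
      revert x y; apply dense_zero; [now apply CC|]; intros x y H.
      apply (along _ _ x y H).
      generalize (f_equal Re (h_transport x y)); unfold Re; simpl; lra.
    + transitivity (Im (hx x y) * v1 + Im (hy x y) * v2); [unfold Im; simpl; ring|].
      revert x y; apply dense_zero; [now apply CC|]; intros x y H.
      apply (along _ _ x y H).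
      generalize (f_equal Im (h_transport x y)); unfold Im; simpl; lra.
  - apply dense_zero; [now apply CC|]; intros x y H.
    destruct (He 1%nat) as [HA HB].
    (* Differentiating [v1 A = v2 B], which holds on the whole plane. *)
    destruct (has_grad_unique _ _ _ _ _ x y
      (has_grad_ext _ (fun _ _ => 0) _ _ _ _
        (fun u v => Rminus_diag_eq _ _ (eq_trans (Rmult_comm v1 (A u v)) (eq_trans (par u v) (Rmult_comm _ _))))
        (fun _ _ => eq_refl) (fun _ _ => eq_refl)
        (has_grad_plus _ _ _ _ _ _ (has_grad_scal v1 _ _ _ HA)
          (has_grad_opp _ _ _ (has_grad_scal v2 _ _ _ HB))))
      (has_grad_const 0)) as [Px Py].
    simpl in Px, Py.
    pose proof (f_equal Re (e1_transport x y)) as T1.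
    pose proof (f_equal Im (e1_transport x y)) as T2.
    pose proof (divergence x y) as D; pose proof (Lpos x y) as L.
    fold (A x y) (B x y) in D.
    assert (U1 : Re (ex 1%nat x y) * v1 + Re (ey 1%nat x y) * v2 = 0).
    { apply (along _ _ x y H); revert T1; unfold Re; simpl; lra. }
    assert (U2 : Im (ex 1%nat x y) * v1 + Im (ey 1%nat x y) * v2 = 0).
    { apply (along _ _ x y H); revert T2; unfold Im; simpl; lra. }
    (* The field [V] is everywhere parallel to [v] and constant in the direction [v], hence
       divergence free; [divergence] is thereby reduced to [V . grad Lambda = 0]. *)
    assert (V : Im (ex 1%nat x y) + Re (ey 1%nat x y) = 0).
    { assert (v2 * (Im (ex 1%nat x y) + Re (ey 1%nat x y)) = 0) by lra.
      assert (v1 * (Im (ex 1%nat x y) + Re (ey 1%nat x y)) = 0) by lra.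
      destruct (NZ x0 y0 N) as [X|X].
      - apply (Rmult_eq_reg_l v2); [lra|exact X].
      - apply (Rmult_eq_reg_l v1); [lra|exact X]. }
    apply (along _ _ x y H); rewrite V in D; lra.
Qed.

Lemma periodic_potential : exists (v1 v2 : R) (h hx hy : R -> R -> C),
  (v1 <> 0 \/ v2 <> 0) /\ has_cgrad h hx hy /\ cperiodic Gamma h /\
  (forall x y, hx x y - Ci * hy x y = RtoC (2 * Omega x y)%R)%C /\
  (forall x y, hx x y * v1 + hy x y * v2 = 0)%C /\
  (forall x y, Lx x y * v1 + Ly x y * v2 = 0).
Proof.
  destruct invariant_direction as (v1 & v2 & N & H1 & H2).
  exists v1, v2, h, hx, hy; repeat (split; [assumption||exact has_cgrad_h||exact cperiodic_h||exact d_h|]).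
  assumption.
Qed.

End Chain.

(** * Real-analytic functions *)

Lemma real_analytic_ext f g :
  (forall x y, f x y = g x y) -> real_analytic f -> real_analytic g.
Proof.
  intros E Hf x0 y0; destruct (Hf x0 y0) as (c & r & Hr & H).
  exists c, r; split; [exact Hr|]; intros x y Hx Hy; rewrite <- E; now apply H.
Qed.

Lemma real_analytic_scal k f : real_analytic f -> real_analytic (fun x y => k * f x y).
Proof.
  intros Hf x0 y0; destruct (Hf x0 y0) as (c & r & Hr & H).
  exists (fun i j => k * c i j), r; split; [exact Hr|]; intros x y Hx Hy.
  destruct (H x y Hx Hy) as [Ha Hs]; split.
  - apply ex_series_ext with (2 := ex_series_scal_l (Rabs k) _ Ha); intros n.
    rewrite scal_sum; apply sum_eq; intros i _.
    rewrite !Rabs_mult; ring.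
  - apply is_series_ext with (2 := is_series_scal_l k _ _ Hs); intros n.
    rewrite scal_sum; apply sum_eq; intros i _; ring.
Qed.

Lemma real_analytic_plus f g :
  real_analytic f -> real_analytic g -> real_analytic (fun x y => f x y + g x y).
Proof.
  intros Hf Hg x0 y0.
  destruct (Hf x0 y0) as (c & r & Hr & H), (Hg x0 y0) as (d & s & Hs & K).
  exists (fun i j => c i j + d i j), (Rmin r s); split; [now apply Rmin_glb_lt|].
  intros x y Hx Hy.
  pose proof (Rmin_l r s); pose proof (Rmin_r r s).
  destruct (H x y ltac:(lra) ltac:(lra)) as [Ha Hb].
  destruct (K x y ltac:(lra) ltac:(lra)) as [Ka Kb]; split.
  - apply (@ex_series_le R_AbsRing R_CompleteNormedModule) with (2 := ex_series_plus _ _ Ha Ka); intros n.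
    unfold norm, plus; simpl.
    rewrite Rabs_pos_eq by (apply cond_pos_sum; intros; apply Rabs_pos).
    rewrite <- plus_sum; apply sum_Rle; intros i _.
    eapply Rle_trans; [|apply Rabs_triang]; right; f_equal; ring.
  - apply is_series_ext with (2 := is_series_plus _ _ _ _ Hb Kb); intros n.
    unfold plus; simpl; rewrite <- plus_sum; apply sum_eq; intros i _; ring.
Qed.

Lemma pow_lipschitz m u u' i :
  Rabs u <= m -> Rabs u' <= m ->
  Rabs (u' ^ i - u ^ i) <= INR i * m ^ pred i * Rabs (u' - u).
Proof.
  intros Hu Hu'; induction i as [|i IH].
  - simpl; rewrite Rminus_diag, Rabs_R0; lra.
  - replace (u' ^ S i - u ^ S i) with (u' ^ i * (u' - u) + u * (u' ^ i - u ^ i)) by (simpl; ring).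
    eapply Rle_trans; [apply Rabs_triang|]; rewrite !Rabs_mult, <- RPow_abs.
    assert (Rabs u' ^ i <= m ^ i) by (apply pow_incr; split; [apply Rabs_pos|exact Hu']).
    pose proof (Rabs_pos (u' - u)); pose proof (Rabs_pos u).
    apply Rle_trans with (m ^ i * Rabs (u' - u) + m * (INR i * m ^ pred i * Rabs (u' - u))).
    + apply Rplus_le_compat; [now apply Rmult_le_compat_r|].
      apply Rmult_le_compat; trivial; apply Rabs_pos.
    + rewrite S_INR; simpl; right; destruct i; simpl; ring.
Qed.

Lemma monomial_lipschitz m u v u' v' i k :
  Rabs u <= m -> Rabs u' <= m -> Rabs v <= m -> Rabs v' <= m ->
  Rabs (u' ^ i * v' ^ k - u ^ i * v ^ k) <=
  INR (i + k) * m ^ pred (i + k) * (Rabs (u' - u) + Rabs (v' - v)).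
Proof.
  intros Hu Hu' Hv Hv'.
  assert (Hm : 0 <= m) by (eapply Rle_trans; [apply Rabs_pos|exact Hu]).
  replace (u' ^ i * v' ^ k - u ^ i * v ^ k)
    with (u' ^ i * (v' ^ k - v ^ k) + v ^ k * (u' ^ i - u ^ i)) by ring.
  eapply Rle_trans; [apply Rabs_triang|]; rewrite !Rabs_mult, <- !RPow_abs.
  pose proof (pow_lipschitz m u u' i Hu Hu') as Li.
  pose proof (pow_lipschitz m v v' k Hv Hv') as Lk.
  assert (Pu : Rabs u' ^ i <= m ^ i) by (apply pow_incr; split; [apply Rabs_pos|exact Hu']).
  assert (Pv : Rabs v ^ k <= m ^ k) by (apply pow_incr; split; [apply Rabs_pos|exact Hv]).
  apply Rle_trans with (m ^ i * (INR k * m ^ pred k * Rabs (v' - v))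
    + m ^ k * (INR i * m ^ pred i * Rabs (u' - u))).
  { apply Rplus_le_compat; apply Rmult_le_compat; trivial;
      try apply Rabs_pos; apply pow_le, Rabs_pos. }
  assert (E : m ^ i * (INR k * m ^ pred k) = INR k * m ^ pred (i + k)).
  { destruct k; [simpl; ring|].
    replace (pred (i + S k)) with (i + k)%nat by lia; rewrite pow_add; simpl pred; ring. }
  assert (E' : m ^ k * (INR i * m ^ pred i) = INR i * m ^ pred (i + k)).
  { destruct i; [simpl; ring|].
    replace (pred (S i + k)) with (i + k)%nat by lia; rewrite pow_add; simpl pred; ring. }
  rewrite <- !Rmult_assoc in *; rewrite E, E', plus_INR.
  pose proof (pos_INR i); pose proof (pos_INR k).
  pose proof (pow_le m (pred (i + k)) Hm) as Pm.
  pose proof (Rabs_pos (u' - u)); pose proof (Rabs_pos (v' - v)).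
  assert (0 <= INR i * m ^ pred (i + k)) by now apply Rmult_le_pos.
  assert (0 <= INR k * m ^ pred (i + k)) by now apply Rmult_le_pos.
  nra.
Qed.

Lemma is_series_bound t l b K :
  is_series t l -> ex_series b -> (forall n, Rabs (t n) <= K * b n) ->
  Rabs l <= K * Series b.
Proof.
  intros Ht Hb B.
  rewrite <- (is_series_unique _ _ Ht), <- Series_scal_l.
  assert (X : ex_series (fun n => K * b n)) by exact (ex_series_scal_l K b Hb).
  eapply Rle_trans; [apply Series_Rabs|].
  - apply (@ex_series_le R_AbsRing R_CompleteNormedModule) with (2 := X); intros n.
    unfold norm; simpl; now rewrite Rabs_Rabsolu.
  - apply Series_le; [|exact X]; intros n; split; [apply Rabs_pos|apply B].
Qed.

Lemma INR_le_pow2 n : INR n <= 2 ^ n.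
Proof.
  induction n as [|n IH]; [simpl; lra|].
  rewrite S_INR; simpl; pose proof (pow_R1_Rle 2 n ltac:(lra)); lra.
Qed.

(** On a box of half-width [m] the remainder after the linear terms is Lipschitz with constant
    [K m]. With base point at the centre this gives differentiability there; with a moving base
    point it bounds the distance of nearby derivatives from [a], [b], hence their continuity. Thus
    no series is differentiated termwise. *)
Lemma analytic_remainder f x0 y0 :
  real_analytic f -> exists a b K d, 0 < d /\ 0 <= K /\
  forall m u v u' v', m <= d ->
    Rabs u <= m -> Rabs u' <= m -> Rabs v <= m -> Rabs v' <= m ->
    Rabs (f (x0 + u') (y0 + v') - f (x0 + u) (y0 + v) - (a * (u' - u) + b * (v' - v)))
      <= K * m * (Rabs (u' - u) + Rabs (v' - v)).
Proof.
  intros Hf; destruct (Hf x0 y0) as (c & r & Hr & H).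
  (* Half the radius puts [(x0 + rho, y0 + rho)] inside the domain of convergence, where absolute
     convergence makes [k] summable. *)
  set (rho := r / 2).
  assert (Prho : 0 < rho) by (unfold rho; lra).
  set (k := fun n => sum_f_R0 (fun j => Rabs (c (n - j)%nat j)) n * rho ^ n).
  assert (Hk : ex_series k).
  { destruct (H (x0 + rho) (y0 + rho)) as [Ha _];
      try (rewrite Rplus_minus_l, Rabs_pos_eq; unfold rho; lra).
    apply ex_series_ext with (2 := Ha); intros n; unfold k.
    rewrite Rmult_comm, scal_sum; apply sum_eq; intros j Hj.
    rewrite !Rplus_minus_l, Rmult_assoc, <- pow_add, Rabs_mult.
    replace (n - j + j)%nat with n by lia.
    rewrite (Rabs_pos_eq (rho ^ n)) by (apply pow_le; lra); ring. }
  assert (Pk : forall n, 0 <= k n).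
  { intros n; apply Rmult_le_pos; [|apply pow_le; lra].
    apply cond_pos_sum; intros; apply Rabs_pos. }
  assert (Hk2 : ex_series (fun n => k (S (S n)))) 
    by exact (proj1 (ex_series_incr_1 (fun n => k (S n))) (proj1 (ex_series_incr_1 k) Hk)).
  (* For [N = n + 2] and [m <= rho / 2], one has [N m^(N-1) <= 2^N m (rho / 2)^n = (4 / rho^2) m
     rho^N], hence the constant. *)
  exists (c 1%nat 0%nat), (c 0%nat 1%nat), (4 / rho ^ 2 * Series (fun n => k (S (S n)))), (rho / 2).
  split; [lra|]; split.
  { apply Rmult_le_pos; [apply Rlt_le, Rdiv_lt_0_compat; [lra|now apply pow_lt]|].
    rewrite <- (Rmult_0_l (Series (fun n => k (S (S n))))) at 1.
    rewrite <- Series_scal_l; apply Series_le; [|exact Hk2].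
    intros n; rewrite Rmult_0_l; split; [lra|apply Pk]. }
  intros m u v u' v' Hm Hu Hu' Hv Hv'.
  assert (Pm : 0 <= m) by (eapply Rle_trans; [apply Rabs_pos|exact Hu]).
  set (dist := Rabs (u' - u) + Rabs (v' - v)).
  assert (Pdist : 0 <= dist) by (apply Rplus_le_le_0_compat; apply Rabs_pos).
  set (phi := fun p q n => sum_f_R0 (fun j => c (n - j)%nat j * p ^ (n - j) * q ^ j) n).
  assert (Hphi : forall p q, Rabs p <= m -> Rabs q <= m ->
    is_series (phi p q) (f (x0 + p) (y0 + q))).
  { intros p q Hp Hq.
    destruct (H (x0 + p) (y0 + q)) as [_ Hs]; try (rewrite Rplus_minus_l; unfold rho in Hm; lra).
    now rewrite !Rplus_minus_l in Hs. }
  pose proof (is_series_minus _ _ _ _ (Hphi u' v' Hu' Hv') (Hphi u v Hu Hv)) as St.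
  unfold minus, plus, opp in St; simpl in St.
  set (t := fun n => phi u' v' n + - phi u v n) in *.
  set (l := f (x0 + u') (y0 + v') - f (x0 + u) (y0 + v)
            - (c 1%nat 0%nat * (u' - u) + c 0%nat 1%nat * (v' - v))).
  assert (S2 : is_series (fun n => t (S (S n))) l).
  { apply (is_series_incr_1 (V := R_NormedModule) (fun n => t (S n))).
    apply (is_series_incr_1 (V := R_NormedModule) t).
    unfold plus; simpl.
    replace (l + t 1%nat + t 0%nat) with (f (x0 + u') (y0 + v') + - f (x0 + u) (y0 + v));
      [exact St|].
    unfold l, t, phi; simpl; ring. }
  replace (4 / rho ^ 2 * Series (fun n => k (S (S n))) * m * dist)
    with (4 / rho ^ 2 * (m * dist) * Series (fun n => k (S (S n)))) by ring.
  apply is_series_bound with (1 := S2) (2 := Hk2).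
  intros n; set (N := S (S n)).
  apply Rle_trans with (sum_f_R0 (fun j => Rabs (c (N - j)%nat j)) N * (INR N * m ^ pred N * dist)).
  - unfold t, phi.
    replace (sum_f_R0 (fun j => c (N - j)%nat j * u' ^ (N - j) * v' ^ j) N +
             - sum_f_R0 (fun j => c (N - j)%nat j * u ^ (N - j) * v ^ j) N)
      with (sum_f_R0 (fun j => c (N - j)%nat j * (u' ^ (N - j) * v' ^ j - u ^ (N - j) * v ^ j)) N).
    2: { fold (Rminus (sum_f_R0 (fun j => c (N - j)%nat j * u' ^ (N - j) * v' ^ j) N)
               (sum_f_R0 (fun j => c (N - j)%nat j * u ^ (N - j) * v ^ j) N)).
         rewrite <- minus_sum; apply sum_eq; intros; ring. }
    eapply Rle_trans; [apply Rsum_abs|].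
    rewrite Rmult_comm, scal_sum; apply sum_Rle; intros j Hj.
    rewrite Rabs_mult; apply Rmult_le_compat_l; [apply Rabs_pos|].
    pose proof (monomial_lipschitz m u v u' v' (N - j) j Hu Hu' Hv Hv') as L.
    replace (N - j + j)%nat with N in L by lia; exact L.
  - fold N; unfold k.
    replace (4 / rho ^ 2 * (m * dist) * (sum_f_R0 (fun j => Rabs (c (N - j)%nat j)) N * rho ^ N))
      with (sum_f_R0 (fun j => Rabs (c (N - j)%nat j)) N * (4 / rho ^ 2 * m * rho ^ N * dist)) by ring.
    apply Rmult_le_compat_l; [apply cond_pos_sum; intros; apply Rabs_pos|].
    apply Rmult_le_compat_r; [exact Pdist|].
    unfold N; simpl pred.
    apply Rle_trans with (INR N * (m * (rho / 2) ^ n)).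
    + unfold N; apply Rmult_le_compat_l; [apply pos_INR|]; simpl.
      apply Rmult_le_compat_l; [exact Pm|]; apply pow_incr; lra.
    + apply Rle_trans with (2 ^ N * (m * (rho / 2) ^ n)).
      * apply Rmult_le_compat_r; [|apply INR_le_pow2].
        apply Rmult_le_pos; [exact Pm|apply pow_le; lra].
      * right; unfold N; simpl pow; unfold Rdiv; rewrite Rpow_mult_distr, pow_inv.
        field; split; [lra|]; apply pow_nonzero; lra.
Qed.

Lemma is_derive_of_quadratic_remainder g x l K d :
  0 < d -> 0 <= K -> (forall h, Rabs h <= d -> Rabs (g (x + h) - g x - l * h) <= K * Rabs h * Rabs h) ->
  is_derive g x l.
Proof.
  intros Hd HK H; apply is_derive_Reals; intros eps He.
  assert (P : 0 < Rmin d (eps / (K + 1))).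
  { apply Rmin_glb_lt; [exact Hd|apply Rdiv_lt_0_compat; lra]. }
  exists (mkposreal _ P); intros h Hh Hl; simpl in Hl.
  pose proof (Rmin_l d (eps / (K + 1))); pose proof (Rmin_r d (eps / (K + 1))).
  specialize (H h ltac:(lra)).
  pose proof (Rabs_pos_lt h Hh) as Ph.
  replace ((g (x + h) - g x) / h - l) with ((g (x + h) - g x - l * h) / h) by (field; exact Hh).
  unfold Rdiv at 1; rewrite Rabs_mult, Rabs_inv.
  apply Rle_lt_trans with (K * Rabs h).
  - apply Rle_div_l; [exact Ph|exact H].
  - apply Rle_lt_trans with ((K + 1) * Rabs h); [nra|].
    rewrite Rmult_comm; apply Rlt_div_r; [lra|]; lra.
Qed.

Lemma derivative_bound g x l b M d :
  0 < d -> is_derive g x l ->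
  (forall h, Rabs h <= d -> Rabs (g (x + h) - g x - b * h) <= M * Rabs h) ->
  Rabs (l - b) <= M.
Proof.
  intros Hd Hg H; apply is_derive_Reals in Hg.
  apply le_epsilon; intros eps He.
  destruct (Hg eps He) as [d' Hd'].
  pose proof (Rmin_l d d'); pose proof (Rmin_r d d').
  assert (P : 0 < Rmin d d') by (apply Rmin_glb_lt; [exact Hd|apply d']).
  set (h := Rmin d d' / 2) in *.
  assert (Ph : 0 < h) by (unfold h; lra).
  assert (Ah : Rabs h = h) by (apply Rabs_pos_eq; lra).
  specialize (Hd' h ltac:(lra) ltac:(rewrite Ah; unfold h; lra)).
  specialize (H h ltac:(rewrite Ah; unfold h; lra)); rewrite Ah in H.
  assert (X : Rabs ((g (x + h) - g x) / h - b) <= M).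
  { replace ((g (x + h) - g x) / h - b) with ((g (x + h) - g x - b * h) / h) by (field; lra).
    unfold Rdiv; rewrite Rabs_mult, Rabs_inv, Ah; apply Rle_div_l; [exact Ph|exact H]. }
  replace (l - b) with (- ((g (x + h) - g x) / h - l) + ((g (x + h) - g x) / h - b)) by ring.
  eapply Rle_trans; [apply Rabs_triang|]; rewrite Rabs_Ropp; lra.
Qed.

Lemma real_analytic_has_grad f :
  real_analytic f ->
  has_grad f (fun x y => Derive (fun t => f t y) x) (fun x y => Derive (fun t => f x t) y).
Proof.
  intros Hf.
  assert (D : forall x y, ex_derive (fun t => f t y) x /\ ex_derive (fun t => f x t) y).
  { intros x y; destruct (analytic_remainder f x y Hf) as (a & b & K & d & Hd & HK & H); split.
    - exists a; apply (is_derive_of_quadratic_remainder _ x a K d Hd HK); intros h Hh.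
      generalize (H (Rabs h) 0 0 h 0 Hh); rewrite Rabs_R0, !Rplus_0_r, !Rminus_0_r, Rabs_R0.
      rewrite Rmult_0_r, !Rplus_0_r; intros X; apply X; try apply Rle_refl; apply Rabs_pos.
    - exists b; apply (is_derive_of_quadratic_remainder _ y b K d Hd HK); intros h Hh.
      generalize (H (Rabs h) 0 0 0 h Hh); rewrite Rabs_R0, !Rplus_0_r, !Rminus_0_r, Rabs_R0.
      rewrite Rmult_0_r, !Rplus_0_l; intros X; apply X; try apply Rle_refl; apply Rabs_pos. }
  (* Near the centre the derivatives are close to the linear coefficients of the expansion there.
     Applied to the centre itself as well, this gives continuity with two halves of [eps]. *)
  assert (C : forall x0 y0 (eps : posreal), exists (d : posreal) a b, forall x y,
    Rabs (x - x0) < d -> Rabs (y - y0) < d ->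
    Rabs (Derive (fun t => f t y) x - a) < eps /\ Rabs (Derive (fun t => f x t) y - b) < eps).
  { intros x0 y0 eps.
    destruct (analytic_remainder f x0 y0 Hf) as (a & b & K & d & Hd & HK & H).
    set (m := Rmin d (eps / (K + 1))).
    pose proof (cond_pos eps).
    assert (Pm : 0 < m) by (apply Rmin_glb_lt; [exact Hd|apply Rdiv_lt_0_compat; lra]).
    assert (Hm : m <= d) by apply Rmin_l.
    assert (He : K * m < eps).
    { apply Rlt_le_trans with ((K + 1) * m); [nra|].
      rewrite Rmult_comm; apply Rle_div_r; [lra|apply Rmin_r]. }
    assert (Pm2 : 0 < m / 2) by lra.
    exists (mkposreal _ Pm2), a, b; simpl; intros x y Hx Hy.
    split; apply Rle_lt_trans with (2 := He).
    - apply (derivative_bound (fun t => f t y) x _ a (K * m) (m / 2) Pm2).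
      { apply Derive_correct; exact (proj1 (D x y)). }
      intros h Hh.
      generalize (H m (x - x0) (y - y0) (x - x0 + h) (y - y0) Hm ltac:(lra)
        ltac:(eapply Rle_trans; [apply Rabs_triang|lra]) ltac:(lra) ltac:(lra)).
      replace (x0 + (x - x0 + h)) with (x + h) by ring.
      replace (x0 + (x - x0)) with x by ring.
      replace (y0 + (y - y0)) with y by ring.
      replace (x - x0 + h - (x - x0)) with h by ring.
      rewrite Rminus_diag, Rabs_R0, Rmult_0_r, !Rplus_0_r; trivial.
    - apply (derivative_bound (fun t => f x t) y _ b (K * m) (m / 2) Pm2).
      { apply Derive_correct; exact (proj2 (D x y)). }
      intros h Hh.
      generalize (H m (x - x0) (y - y0) (x - x0) (y - y0 + h) Hm ltac:(lra) ltac:(lra) ltac:(lra)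
        ltac:(eapply Rle_trans; [apply Rabs_triang|lra])).
      replace (y0 + (y - y0 + h)) with (y + h) by ring.
      replace (x0 + (x - x0)) with x by ring.
      replace (y0 + (y - y0)) with y by ring.
      replace (y - y0 + h - (y - y0)) with h by ring.
      rewrite Rminus_diag, Rabs_R0, Rmult_0_r, !Rplus_0_l; trivial. }
  refine (conj _ (conj _ (conj _ _))); intros x y.
  - apply Derive_correct; exact (proj1 (D x y)).
  - apply Derive_correct; exact (proj2 (D x y)).
  - intros eps; destruct (C x y (pos_div_2 eps)) as (d & a & b & H); exists d; intros u v Hu Hv.
    destruct (H u v Hu Hv) as [H1 _].
    destruct (H x y) as [H2 _]; try (rewrite Rminus_diag, Rabs_R0; apply d).
    simpl in H1, H2; rewrite Rabs_minus_sym in H2.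
    apply Rle_lt_trans with (1 := R_dist_tri _ _ a); unfold R_dist; lra.
  - intros eps; destruct (C x y (pos_div_2 eps)) as (d & a & b & H); exists d; intros u v Hu Hv.
    destruct (H u v Hu Hv) as [_ H1].
    destruct (H x y) as [_ H2]; try (rewrite Rminus_diag, Rabs_R0; apply d).
    simpl in H1, H2; rewrite Rabs_minus_sym in H2.
    apply Rle_lt_trans with (1 := R_dist_tri _ _ b); unfold R_dist; lra.
Qed.

(** * Identity theorem for real-analytic functions *)

Lemma power_series_left_zero_0 d c :
  0 < d -> (forall s, - d < s < 0 -> is_series (fun n => c n * s ^ n) 0) -> c 0%nat = 0.
Proof.
  intros Hd H.
  (* With radius of convergence 0 the terms at [- d / 2] could not tend to 0, although the series
     converges there. *)
  assert (Rc : Rbar_lt (Rabs 0) (CV_radius c)).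
  { apply Rbar_not_le_lt; intros X.
    apply (CV_disk_outside c (- d / 2)).
    - eapply Rbar_le_lt_trans; [exact X|]; simpl; rewrite Rabs_R0.
      apply Rabs_pos_lt; lra.
    - apply (ex_series_lim_0 (fun n => c n * (- d / 2) ^ n)); eexists; apply H; lra. }
  pose proof (PSeries_continuity c 0 Rc) as C.
  rewrite <- (PSeries_0 c).
  apply Classical_Prop.NNPP; intros N.
  destruct (C (Rabs (PSeries c 0))) as (a & Ha & C'); [now apply Rabs_pos_lt|].
  assert (P : 0 < Rmin a d) by (apply Rmin_glb_lt; [exact Ha|exact Hd]).
  pose proof (Rmin_l a d); pose proof (Rmin_r a d).
  set (s := - Rmin a d / 2) in *.
  assert (Hs : s < 0) by (unfold s; lra).
  assert (E : PSeries c s = 0) by (apply is_series_unique, H; unfold s in *; lra).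
  specialize (C' s); simpl in C'; unfold R_dist in C'; rewrite E in C'.
  rewrite Rminus_0_l, Rabs_Ropp in C'; apply (Rlt_irrefl (Rabs (PSeries c 0))), C'.
  split; [split; [exact I|lra]|].
  rewrite Rminus_0_r, Rabs_left by exact Hs; unfold s; lra.
Qed.

(** One-sided zeros suffice, and [analytic_zero_right] has no others: it knows [phi] only to the
    left of a supremum. Division by [s] shifts the series, so each coefficient becomes a constant
    term in turn. *)
Lemma power_series_left_zero d c :
  0 < d -> (forall s, - d < s < 0 -> is_series (fun n => c n * s ^ n) 0) -> forall n, c n = 0.
Proof.
  intros Hd H n; revert c H; induction n as [|n IH]; intros c H.
  - now apply (power_series_left_zero_0 d).
  - assert (c0 : c 0%nat = 0) by now apply (power_series_left_zero_0 d).
    apply (IH (fun n => c (S n))); intros s Hs.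
    assert (S1 : is_series (fun n => c (S n) * s ^ S n) 0).
    { apply (is_series_incr_1 (V := R_NormedModule) (fun n => c n * s ^ n)).
      unfold plus; simpl; rewrite c0, Rmult_0_l, Rplus_0_l; now apply H. }
    apply (is_series_scal_l (/ s)) in S1.
    rewrite <- (Rmult_0_r (/ s)); apply is_series_ext with (2 := S1); intros k.
    change (/ s * (c (S k) * (s * s ^ k)) = c (S k) * s ^ k); field; lra.
Qed.

(** Summation over the total degree pays off here: on a line the terms of degree [n] are together a
    multiple of [s^n], with no rearrangement. *)
Lemma real_analytic_line f x0 y0 a b :
  real_analytic f -> forall t0, exists (c : nat -> R) d, 0 < d /\ forall s, Rabs s < d ->
    is_series (fun n => c n * s ^ n) (f (x0 + (t0 + s) * a) (y0 + (t0 + s) * b)).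
Proof.
  intros Hf t0; destruct (Hf (x0 + t0 * a) (y0 + t0 * b)) as (c & r & Hr & H).
  pose proof (Rabs_pos a); pose proof (Rabs_pos b).
  exists (fun n => sum_f_R0 (fun k => c (n - k)%nat k * a ^ (n - k) * b ^ k) n),
    (r / (Rabs a + Rabs b + 1)).
  split; [apply Rdiv_lt_0_compat; lra|]; intros s Hs.
  apply Rlt_div_r in Hs; [|lra].
  pose proof (Rabs_pos s).
  destruct (H (x0 + (t0 + s) * a) (y0 + (t0 + s) * b)) as [_ S].
  - replace (x0 + (t0 + s) * a - (x0 + t0 * a)) with (s * a) by ring; rewrite Rabs_mult; nra.
  - replace (y0 + (t0 + s) * b - (y0 + t0 * b)) with (s * b) by ring; rewrite Rabs_mult; nra.
  - apply is_series_ext with (2 := S); intros n.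
    symmetry; rewrite Rmult_comm, scal_sum; apply sum_eq; intros k Hk.
    replace (x0 + (t0 + s) * a - (x0 + t0 * a)) with (s * a) by ring.
    replace (y0 + (t0 + s) * b - (y0 + t0 * b)) with (s * b) by ring.
    rewrite !Rpow_mult_distr.
    replace (s ^ n) with (s ^ (n - k) * s ^ k) by (rewrite <- pow_add; f_equal; lia); ring.
Qed.

Lemma analytic_zero_right phi e :
  (forall t0, exists (c : nat -> R) d, 0 < d /\ forall s, Rabs s < d ->
    is_series (fun n => c n * s ^ n) (phi (t0 + s))) ->
  0 < e -> (forall t, 0 <= t < e -> phi t = 0) -> forall t, 0 <= t -> phi t = 0.
Proof.
  intros An He Z T HT; apply Classical_Prop.NNPP; intros N.
  (* [tau] is the end of the longest interval from 0 on which [phi] vanishes, finite because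
     [phi T <> 0]. The expansion at [tau] has zero coefficients, which pushes the zeros beyond
     [tau]. *)
  destruct (completeness (fun t => forall s, 0 <= s < t -> phi s = 0)) as (tau & H1 & H2).
  { exists T; intros t Ht; apply Rnot_lt_le; intros L; apply N, Ht; lra. }
  { exists e; exact Z. }
  assert (Le : e <= tau) by (apply H1, Z).
  assert (Zt : forall s, 0 <= s < tau -> phi s = 0).
  { intros s Hs; apply Classical_Prop.NNPP; intros X.
    assert (tau <= s); [|lra].
    apply H2; intros t Ht; apply Rnot_lt_le; intros L; apply X, Ht; lra. }
  destruct (An tau) as (c & d & Hd & S).
  assert (P : 0 < Rmin d tau) by (apply Rmin_glb_lt; lra).
  pose proof (Rmin_l d tau); pose proof (Rmin_r d tau).
  assert (C0 : forall n, c n = 0).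
  { apply (power_series_left_zero (Rmin d tau)); [exact P|]; intros s Hs.
    rewrite <- (Zt (tau + s)) by lra; apply S; rewrite Rabs_left; lra. }
  assert (tau + d <= tau); [|lra].
  apply H1; intros s Hs; destruct (Rlt_le_dec s tau); [apply Zt; lra|].
  replace s with (tau + (s - tau)) by ring.
  rewrite <- (is_series_unique _ _ (S (s - tau) ltac:(rewrite Rabs_pos_eq; lra))).
  (* Written as [0 * 0] so that [Series_scal_l] evaluates the zero series. *)
  assert (E0 : forall n, c n * (s - tau) ^ n = 0 * 0) by (intros n; rewrite C0; ring).
  rewrite (Series_ext _ _ E0), Series_scal_l; apply Rmult_0_l.
Qed.

Lemma real_analytic_continuation f x0 y0 :
  real_analytic f -> locally_2d (fun x y => f x y = 0) x0 y0 -> forall x y, f x y = 0.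
Proof.
  intros Hf [d Z] x y.
  pose proof (Rabs_pos (x - x0)); pose proof (Rabs_pos (y - y0)); pose proof (cond_pos d).
  pose proof (analytic_zero_right (fun t => f (x0 + t * (x - x0)) (y0 + t * (y - y0)))
    (d / (Rabs (x - x0) + Rabs (y - y0) + 1)) (real_analytic_line f x0 y0 _ _ Hf)) as A.
  replace x with (x0 + 1 * (x - x0)) by ring.
  replace y with (y0 + 1 * (y - y0)) by ring.
  apply A; [apply Rdiv_lt_0_compat; lra| |lra].
  intros t [Ht1 Ht2]; apply Rlt_div_r in Ht2; [|lra].
  apply Z.
  - replace (x0 + t * (x - x0) - x0) with (t * (x - x0)) by ring.
    rewrite Rabs_mult, Rabs_pos_eq by exact Ht1; nra.
  - replace (y0 + t * (y - y0) - y0) with (t * (y - y0)) by ring.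
    rewrite Rabs_mult, Rabs_pos_eq by exact Ht1; nra.
Qed.

(** * Polynomials in the complex momenta *)

Fixpoint csum (n : nat) (f : nat -> C) : C :=
  match n with
  | O => 0
  | S n => (csum n f + f n)%C
  end.

Lemma csum_ext n f g : (forall i, (i < n)%nat -> f i = g i) -> csum n f = csum n g.
Proof.
  induction n as [|n IH]; intros H; simpl; [easy|].
  rewrite IH, H; [easy|lia|intros; apply H; lia].
Qed.

Lemma csum_zero n (f : nat -> C) : (forall i, (i < n)%nat -> f i = 0) -> csum n f = 0.
Proof.
  induction n as [|n IH]; intros H; simpl; [easy|].
  rewrite IH, H; [ring|lia|intros; apply H; lia].
Qed.

Lemma csum_plus n f g : (csum n f + csum n g)%C = csum n (fun i => f i + g i)%C.
Proof. induction n as [|n IH]; simpl; [ring|]; rewrite <- IH; ring. Qed.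

Lemma csum_scal c n f : (c * csum n f)%C = csum n (fun i => c * f i)%C.
Proof. induction n as [|n IH]; simpl; [ring|]; rewrite <- IH; ring. Qed.

Lemma csum_S_l n f : csum (S n) f = (f 0%nat + csum n (fun i => f (S i)))%C.
Proof.
  induction n as [|n IH]; [simpl; ring|].
  change (csum (S (S n)) f) with (csum (S n) f + f (S n))%C; rewrite IH; simpl; ring.
Qed.

Lemma csum_rev n f : csum (S n) f = csum (S n) (fun i => f (n - i)%nat).
Proof.
  revert f; induction n as [|n IH]; intros f; [reflexivity|].
  rewrite csum_S_l, IH.
  change (csum (S (S n)) (fun i => f (S n - i)%nat))
    with (csum (S n) (fun i => f (S n - i)%nat) + f (S n - S n)%nat)%C.
  rewrite Nat.sub_diag, Cplus_comm; f_equal.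
  apply csum_ext; intros i Hi; f_equal; lia.
Qed.

Lemma csum_conj n f : Cconj (csum n f) = csum n (fun i => Cconj (f i)).
Proof.
  induction n as [|n IH]; simpl; [unfold Cconj; simpl; rewrite Ropp_0; reflexivity|].
  now rewrite Cplus_conj, IH.
Qed.

Lemma csum_RtoC n f : RtoC (sum_f_R0 f n) = csum (S n) (fun i => RtoC (f i)).
Proof.
  induction n as [|n IH]; [simpl; ring|].
  simpl sum_f_R0; rewrite RtoC_plus, IH; reflexivity.
Qed.

Lemma has_cgrad_csum n f fx fy :
  (forall i, has_cgrad (f i) (fx i) (fy i)) ->
  has_cgrad (fun x y => csum n (fun i => f i x y)) (fun x y => csum n (fun i => fx i x y))
    (fun x y => csum n (fun i => fy i x y)).
Proof.
  intros H; induction n as [|n IH]; simpl.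
  - apply (has_cgrad_const 0).
  - now apply has_cgrad_plus.
Qed.

(** Horner's scheme. Polynomials are bare coefficient functions, so the second conjunct carries the
    vanishing of the quotient's coefficients back to [c]. *)
Lemma synthetic_division n : forall (c : nat -> C) (a : C), exists q : nat -> C,
  (forall z : C, csum (S n) (fun j => c j * z ^ j) - csum (S n) (fun j => c j * a ^ j)
     = (z - a) * csum n (fun j => q j * z ^ j))%C /\
  ((forall j, (j < n)%nat -> q j = 0) -> forall j, (0 < j <= n)%nat -> c j = 0).
Proof.
  assert (H : forall n (c : nat -> C) z, csum (S n) (fun j => c j * z ^ j)%C
    = (c 0%nat + z * csum n (fun j => c (S j) * z ^ j))%C).
  { intros k c z; rewrite csum_S_l, csum_scal; simpl; f_equal; [ring|].
    apply csum_ext; intros; ring. }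
  induction n as [|n IH]; intros c a.
  - exists (fun _ => 0); split; [|intros; lia].
    intros z; simpl; ring.
  - destruct (IH (fun j => c (S j)) a) as (q & Hq & Zq).
    set (q' := fun j => match j with
                        | O => csum (S n) (fun j => c (S j) * a ^ j)%C
                        | S j => q j
                        end).
    exists q'; split.
    + intros z; specialize (Hq z).
      rewrite (H (S n) c z), (H (S n) c a), (H n q' z).
      change (q' 0%nat) with (csum (S n) (fun j => c (S j) * a ^ j)%C).
      change (csum n (fun j => q' (S j) * z ^ j)%C) with (csum n (fun j => q j * z ^ j)%C).
      replace (csum (S n) (fun j => c (S j) * z ^ j)%C)
        with ((z - a) * csum n (fun j => q j * z ^ j) + csum (S n) (fun j => c (S j) * a ^ j))%C
        by (rewrite <- Hq; ring).
      ring.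
    + intros Z.
      assert (Zc : forall j, (0 < j <= n)%nat -> c (S j) = 0).
      { apply Zq; intros j Hj; apply (Z (S j)); lia. }
      intros [|[|j]] Hj; [lia| |apply Zc; lia].
      rewrite <- (Z 0%nat ltac:(lia)); simpl (q' 0%nat).
      change (c 1%nat = csum (S n) (fun j => c (S j) * a ^ j)%C).
      rewrite csum_S_l, csum_zero; [simpl; ring|].
      intros i Hi; rewrite Zc by lia; ring.
Qed.

Lemma polynomial_zero n : forall (c : nat -> C) (z : nat -> C),
  (forall i j, (i < n)%nat -> (j < n)%nat -> i <> j -> z i <> z j) ->
  (forall i, (i < n)%nat -> csum n (fun j => c j * z i ^ j)%C = 0) ->
  forall j, (j < n)%nat -> c j = 0.
Proof.
  induction n as [|n IH]; intros c z D Z; [lia|].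
  destruct (synthetic_division n c (z n)) as (q & Hq & Zq).
  assert (Q : forall j, (j < n)%nat -> q j = 0).
  { apply (IH q z); [intros; apply D; lia|]; intros i Hi.
    specialize (Hq (z i)); rewrite !Z in Hq by lia.
    apply Classical_Prop.NNPP; intros N.
    apply (Cmult_neq_0 (z i - z n) (csum n (fun j => q j * z i ^ j)%C)); [|exact N|].
    - apply Cminus_eq_contra, D; lia.
    - rewrite <- Hq; ring. }
  assert (C : forall j, (0 < j <= n)%nat -> c j = 0) by now apply Zq.
  intros [|j] Hj; [|apply C; lia].
  specialize (Z n ltac:(lia)); rewrite csum_S_l, csum_zero in Z.
  - rewrite <- Z; simpl; ring.
  - intros i Hi; rewrite C by lia; ring.
Qed.

Definition homog (s : nat) (c : nat -> nat -> C) (xi eta : C) : C :=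
  csum (S s) (fun i => c i (s - i)%nat * xi ^ i * eta ^ (s - i))%C.

(** The bound is exclusive: degree [N] is [poly2 (S N)], and the bracket of such a polynomial with
    [H] is a [poly2 (S (S N))]. *)
Definition poly2 (n : nat) (c : nat -> nat -> C) (xi eta : C) : C :=
  csum n (fun s => homog s c xi eta).

Definition shift1 (c : nat -> nat -> C) (i k : nat) : C :=
  match i with O => 0 | S i => c i k end.

Definition shift2 (c : nat -> nat -> C) (i k : nat) : C :=
  match k with O => 0 | S k => c i k end.

Lemma homog_ext s c d xi eta :
  (forall i k, c i k = d i k) -> homog s c xi eta = homog s d xi eta.
Proof. intros H; apply csum_ext; intros; now rewrite H. Qed.

Lemma homog_shift1 s c xi eta :
  (xi * homog s c xi eta = homog (S s) (shift1 c) xi eta)%C.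
Proof.
  unfold homog; rewrite (csum_S_l (S s)), csum_scal; simpl (shift1 c 0%nat _).
  rewrite !Cmult_0_l, Cplus_0_l; apply csum_ext; intros i Hi; simpl; ring.
Qed.

Lemma homog_shift2 s c xi eta :
  (eta * homog s c xi eta = homog (S s) (shift2 c) xi eta)%C.
Proof.
  unfold homog; rewrite csum_scal.
  change (csum (S (S s)) ?f) with (csum (S s) f + f (S s))%C.
  cbv beta; rewrite Nat.sub_diag; simpl (shift2 c _ 0%nat).
  rewrite !Cmult_0_l, Cplus_0_r; apply csum_ext; intros i Hi.
  replace (S s - i)%nat with (S (s - i)) by lia; simpl; ring.
Qed.

Lemma poly2_ext n c d xi eta :
  (forall i k, c i k = d i k) -> poly2 n c xi eta = poly2 n d xi eta.
Proof. intros H; apply csum_ext; intros; now apply homog_ext. Qed.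

Lemma poly2_plus n c d xi eta :
  (poly2 n c xi eta + poly2 n d xi eta = poly2 n (fun i k => c i k + d i k) xi eta)%C.
Proof.
  unfold poly2; rewrite csum_plus; apply csum_ext; intros s _.
  unfold homog; rewrite csum_plus; apply csum_ext; intros; ring.
Qed.

Lemma poly2_scal a n c xi eta :
  (a * poly2 n c xi eta = poly2 n (fun i k => a * c i k) xi eta)%C.
Proof.
  unfold poly2; rewrite csum_scal; apply csum_ext; intros s _.
  unfold homog; rewrite csum_scal; apply csum_ext; intros; ring.
Qed.

Lemma poly2_shift1 n c xi eta :
  (xi * poly2 n c xi eta = poly2 (S n) (shift1 c) xi eta)%C.
Proof.
  unfold poly2; rewrite csum_S_l, csum_scal.
  unfold homog at 2; simpl csum at 2; simpl (shift1 c 0%nat _).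
  rewrite !Cmult_0_l, !Cplus_0_l; apply csum_ext; intros; apply homog_shift1.
Qed.

Lemma poly2_shift2 n c xi eta :
  (eta * poly2 n c xi eta = poly2 (S n) (shift2 c) xi eta)%C.
Proof.
  unfold poly2; rewrite csum_S_l, csum_scal.
  unfold homog at 2; simpl csum at 2; simpl (shift2 c _ 0%nat).
  rewrite !Cmult_0_l, !Cplus_0_l; apply csum_ext; intros; apply homog_shift2.
Qed.

Lemma poly2_extend n (c : nat -> nat -> C) xi eta :
  (forall i k, (i + k = n)%nat -> c i k = 0) -> poly2 n c xi eta = poly2 (S n) c xi eta.
Proof.
  intros H; change (poly2 (S n) c xi eta) with (poly2 n c xi eta + homog n c xi eta)%C.
  rewrite <- (Cplus_0_r (poly2 n c xi eta)) at 1; f_equal; symmetry.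
  apply csum_zero; intros i Hi; rewrite H by lia; ring.
Qed.

Lemma homog_scale s c r xi eta :
  (homog s c (r * xi) (r * eta) = homog s c xi eta * r ^ s)%C.
Proof.
  unfold homog; rewrite (Cmult_comm _ (r ^ s)%C), csum_scal; apply csum_ext; intros i Hi.
  rewrite !Cpow_mult_l.
  replace (r ^ s)%C with (r ^ i * r ^ (s - i))%C by (rewrite <- Cpow_add_r; f_equal; lia); ring.
Qed.

(** For real momenta [xi] and [eta] are conjugate and cannot vary independently. Dividing by [eta^s]
    leaves a polynomial in [xi / eta], and [(1 + i t) / (1 - i t)] takes distinct values at
    [t = 0, ..., s]. *)
Lemma homog_zero s c :
  (forall t : R, homog s c (1, t) (1, - t) = 0) ->
  forall i, (i <= s)%nat -> c i (s - i)%nat = 0.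
Proof.
  intros H i Hi.
  set (u := fun t : R => ((1, t) : C)); set (v := fun t : R => ((1, - t) : C)).
  assert (NZ : forall t, v t <> 0).
  { intros t E; apply (f_equal Re) in E; simpl in E; lra. }
  apply (polynomial_zero (S s) (fun i => c i (s - i)%nat)
    (fun j => (u (INR j) / v (INR j))%C)); [| |lia].
  - intros j k _ _ Hjk E; apply Hjk, INR_eq.
    assert (X : (u (INR j) * v (INR k) = u (INR k) * v (INR j))%C).
    { transitivity (u (INR j) / v (INR j) * v (INR j) * v (INR k))%C.
      - field; apply NZ.
      - rewrite E; field; apply NZ. }
    apply (f_equal Im) in X; simpl in X; lra.
  - intros j _; specialize (H (INR j)); fold (u (INR j)) (v (INR j)) in H.
    apply Classical_Prop.NNPP; intros N.
    apply (Cmult_neq_0 (v (INR j) ^ s) _ (Cpow_nz _ s (NZ (INR j))) N).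
    rewrite <- H; unfold homog; rewrite csum_scal; apply csum_ext; intros k Hk.
    unfold Cdiv; rewrite Cpow_mult_l, Cpow_inv by apply NZ.
    replace (v (INR j) ^ s)%C with (v (INR j) ^ k * v (INR j) ^ (s - k))%C
      by (rewrite <- Cpow_add_r; f_equal; lia).
    field; apply Cpow_nz, NZ.
Qed.

(** On the ray through [(1, t)] the homogeneous parts are the coefficients of a polynomial in the
    radius. Each energy level meets the ray at one positive radius [r j], so [n] distinct levels
    give [n] distinct roots and every part vanishes for every [t]. *)
Lemma poly2_zero n c (lam : R) (E : nat -> R) :
  0 < lam -> (forall i, (i < n)%nat -> 0 < E i) ->
  (forall i j, (i < n)%nat -> (j < n)%nat -> i <> j -> E i <> E j) ->
  (forall i p1 p2, (i < n)%nat -> (p1 ^ 2 + p2 ^ 2) / (2 * lam) = E i ->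
    poly2 n c (p1, p2) (p1, - p2) = 0) ->
  forall i k, (i + k < n)%nat -> c i k = 0.
Proof.
  intros Hl HE D Z i k Hik.
  replace k with (i + k - i)%nat by lia.
  apply (homog_zero (i + k)); [|lia]; intros t.
  assert (Pt : 0 < 1 + t ^ 2) by nra.
  set (r := fun j => sqrt (2 * lam * E j / (1 + t ^ 2))).
  assert (Pr : forall j, (j < n)%nat -> 0 < 2 * lam * E j / (1 + t ^ 2)).
  { intros j Hj; pose proof (HE j Hj); apply Rdiv_lt_0_compat; nra. }
  assert (r2 : forall j, (j < n)%nat -> r j ^ 2 = 2 * lam * E j / (1 + t ^ 2)).
  { intros j Hj; apply pow2_sqrt, Rlt_le, Pr, Hj. }
  apply (polynomial_zero n (fun s => homog s c (1, t) (1, - t)) (fun j => RtoC (r j))); trivial.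
  - intros a b Ha Hb Hab X; apply (f_equal Re) in X.
    apply (D a b Ha Hb Hab).
    assert (Y : r a ^ 2 = r b ^ 2) by (simpl in X; now rewrite X).
    rewrite !r2 in Y by assumption.
    apply (Rmult_eq_reg_l (2 * lam / (1 + t ^ 2))).
    + unfold Rdiv in *; lra.
    + apply Rgt_not_eq, Rdiv_lt_0_compat; lra.
  - intros j Hj; rewrite <- (Z j (r j) (r j * t) Hj).
    + unfold poly2; apply csum_ext; intros s _; rewrite <- homog_scale; f_equal.
      * apply C_ext; simpl; ring.
      * apply C_ext; simpl; ring.
    + replace (r j ^ 2 + (r j * t) ^ 2) with (r j ^ 2 * (1 + t ^ 2)) by ring.
      rewrite r2 by exact Hj; field; lra.
Qed.

(* Expansion of [p1^a p2^b] in powers of [xi = p1 + i p2] and [eta = p1 - i p2]. *)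
Fixpoint mono1 (a : nat) : nat -> C :=
  match a with
  | O => fun i => match i with O => 1 | S _ => 0 end
  | S a => fun i => (/ 2 * (match i with O => 0 | S i => mono1 a i end) + / 2 * mono1 a i)%C
  end.

Fixpoint mono (a b : nat) : nat -> C :=
  match b with
  | O => mono1 a
  | S b => fun i =>
      (- Ci / 2 * (match i with O => 0 | S i => mono a b i end) + Ci / 2 * mono a b i)%C
  end.

Lemma linear_factor_expansion s (u v : C) (m : nat -> C) (xi eta : C) :
  (forall i, (s < i)%nat -> m i = 0) ->
  ((u * xi + v * eta) * csum (S s) (fun i => m i * xi ^ i * eta ^ (s - i)) =
   csum (S (S s)) (fun i => (u * (match i with O => 0 | S i => m i end) + v * m i)
     * xi ^ i * eta ^ (S s - i)))%C.
Proof.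
  intros H.
  pose proof (homog_shift1 s (fun i _ => m i) xi eta) as H1.
  pose proof (homog_shift2 s (fun i _ => m i) xi eta) as H2.
  unfold homog in H1, H2.
  transitivity (u * (xi * csum (S s) (fun i => m i * xi ^ i * eta ^ (s - i)))
    + v * (eta * csum (S s) (fun i => m i * xi ^ i * eta ^ (s - i))))%C; [ring|].
  rewrite H1, H2, !csum_scal, csum_plus; apply csum_ext; intros i Hi.
  unfold shift1, shift2.
  destruct (Nat.eq_dec i (S s)) as [->|N].
  - rewrite Nat.sub_diag, (H (S s)) by lia; ring.
  - replace (S s - i)%nat with (S (s - i)) by lia; ring.
Qed.

Lemma mono_expansion a b :
  (forall i, (a + b < i)%nat -> mono a b i = 0) /\
  forall p1 p2 : R, RtoC (p1 ^ a * p2 ^ b) =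
    csum (S (a + b)) (fun i => mono a b i * (p1, p2) ^ i * (p1, - p2)%R ^ (a + b - i))%C.
Proof.
  induction b as [|b [IH1 IH2]].
  - simpl mono; rewrite Nat.add_0_r.
    induction a as [|a [IH1 IH2]].
    + split; [intros [|i] Hi; [lia|reflexivity]|].
      intros p1 p2; apply C_ext; simpl; ring.
    + split.
      * intros [|i] Hi; [lia|]; simpl; rewrite !IH1 by lia; ring.
      * intros p1 p2; simpl mono1; rewrite <- (linear_factor_expansion a), <- IH2 by exact IH1.
        replace (/ 2 * (p1, p2) + / 2 * (p1, - p2)%R)%C with (RtoC p1).
        2: { apply C_ext; simpl; field. }
        rewrite <- RtoC_mult; f_equal; simpl; ring.
  - rewrite Nat.add_succ_r; split.
    + intros [|i] Hi; [lia|]; simpl; rewrite !IH1 by lia; ring.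
    + intros p1 p2; simpl mono; rewrite <- (linear_factor_expansion (a + b)), <- IH2 by exact IH1.
      replace (- Ci / 2 * (p1, p2) + Ci / 2 * (p1, - p2)%R)%C with (RtoC p2).
      2: { apply C_ext; simpl; field. }
      rewrite <- RtoC_mult; f_equal; simpl; ring.
Qed.

(** Complex coefficients are real-linear combinations of the given ones. This notion lets a single
    construction transmit both periodicity and analyticity. *)
Definition linear_class (P : (R -> R -> R) -> Prop) : Prop :=
  (forall f g, (forall x y, f x y = g x y) -> P f -> P g) /\
  P (fun _ _ => 0) /\
  (forall f g, P f -> P g -> P (fun x y => f x y + g x y)) /\
  (forall k f, P f -> P (fun x y => k * f x y)).

Lemma linear_class_csum P n (a : nat -> R -> R -> R) (m : nat -> C) :
  linear_class P -> (forall l, (l < n)%nat -> P (a l)) ->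
  P (fun x y => Re (csum n (fun l => RtoC (a l x y) * m l)%C)) /\
  P (fun x y => Im (csum n (fun l => RtoC (a l x y) * m l)%C)).
Proof.
  intros (Pe & P0 & Pp & Ps) H; induction n as [|n IH]; [easy|].
  destruct IH as [I1 I2]; [intros; apply H; lia|]; split.
  - apply Pe with (2 := Pp _ _ I1 (Ps (Re (m n)) _ (H n ltac:(lia)))).
    intros x y; simpl csum; unfold Re, Im; simpl; ring.
  - apply Pe with (2 := Pp _ _ I2 (Ps (Im (m n)) _ (H n ltac:(lia)))).
    intros x y; simpl csum; unfold Re, Im; simpl; ring.
Qed.

Lemma complex_coefficients N (F : R -> R -> R -> R -> R) (a : nat -> nat -> R -> R -> R) :
  (forall x y p1 p2, F x y p1 p2 =
    sum_f_R0 (fun s => sum_f_R0 (fun k => a s k x y * p1 ^ (s - k) * p2 ^ k) s) N) ->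
  exists b : nat -> nat -> R -> R -> C,
    (forall i k x y, (N < i + k)%nat -> b i k x y = 0) /\
    (forall i k x y, b k i x y = Cconj (b i k x y)) /\
    (forall x y p1 p2, RtoC (F x y p1 p2) =
       poly2 (S N) (fun i k => b i k x y) (p1, p2) (p1, - p2)) /\
    (forall P, linear_class P -> (forall s k, (k <= s <= N)%nat -> P (a s k)) ->
       forall i k, P (fun x y => Re (b i k x y)) /\ P (fun x y => Im (b i k x y))).
Proof.
  intros HF.
  (* The cut-off is needed because nothing is known of [a s k] for [s > N]. *)
  set (b0 := fun i k x y => if le_lt_dec (i + k) N
    then csum (S (i + k)) (fun l => RtoC (a (i + k)%nat l x y) * mono (i + k - l) l i)%C
    else RtoC 0).
  assert (H0 : forall x y p1 p2, RtoC (F x y p1 p2) =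
       poly2 (S N) (fun i k => b0 i k x y) (p1, p2) (p1, - p2)).
  { intros x y p1 p2; rewrite HF, csum_RtoC; apply csum_ext; intros s Hs.
    rewrite csum_RtoC; unfold homog.
    transitivity (csum (S s) (fun k => csum (S s) (fun i =>
      RtoC (a s k x y) * mono (s - k) k i * (p1, p2) ^ i * (p1, - p2)%R ^ (s - i)))%C).
    - apply csum_ext; intros k Hk.
      rewrite Rmult_assoc, RtoC_mult, (proj2 (mono_expansion (s - k) k)), csum_scal.
      replace (s - k + k)%nat with s by lia.
      apply csum_ext; intros; ring.
    - assert (SW : forall n m (f : nat -> nat -> C),
        csum n (fun k => csum m (fun i => f k i)) = csum m (fun i => csum n (fun k => f k i))).
      { intros n m f; induction n as [|n IH]; simpl; [now rewrite csum_zero|].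
        now rewrite IH, csum_plus. }
      rewrite SW; apply csum_ext; intros i Hi.
      unfold b0; replace (i + (s - i))%nat with s by lia.
      destruct (le_lt_dec s N); [|lia].
      rewrite <- Cmult_assoc, (Cmult_comm _ ((p1, p2) ^ i * _)%C), csum_scal.
      apply csum_ext; intros; ring. }
  assert (HB : forall P, linear_class P -> (forall s k, (k <= s <= N)%nat -> P (a s k)) ->
    forall i k, P (fun x y => Re (b0 i k x y)) /\ P (fun x y => Im (b0 i k x y))).
  { intros P HP HA i k; unfold b0; destruct (le_lt_dec (i + k) N).
    - apply (linear_class_csum P _ (a (i + k)%nat) (fun l => mono (i + k - l) l i) HP).
      intros l' Hl; apply HA; lia.
    - split; apply HP. }
  (* [F] is real, so the conjugate transposed array represents it too. Averaging the two gives
     Hermitian symmetry without an appeal to uniqueness of coefficients. *)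
  exists (fun i k x y => / 2 * (b0 i k x y + Cconj (b0 k i x y)))%C.
  repeat split.
  - intros i k x y H; unfold b0.
    destruct (le_lt_dec (i + k) N); [lia|]; destruct (le_lt_dec (k + i) N); [lia|].
    apply C_ext; simpl; ring.
  - intros i k x y.
    destruct (b0 i k x y), (b0 k i x y); apply C_ext; simpl; field.
  - intros x y p1 p2.
    assert (H1 : RtoC (F x y p1 p2) =
      poly2 (S N) (fun i k => Cconj (b0 k i x y)) (p1, p2) (p1, - p2)).
    { transitivity (Cconj (RtoC (F x y p1 p2))); [apply C_ext; simpl; ring|].
      rewrite H0; unfold poly2; rewrite csum_conj; apply csum_ext; intros s _.
      unfold homog; rewrite csum_conj, csum_rev; apply csum_ext; intros i Hi.
      replace (s - (s - i))%nat with i by lia.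
      rewrite !Cmult_conj, !Cpow_conj.
      replace (Cconj (p1, p2)) with ((p1, - p2) : C) by reflexivity.
      replace (Cconj (p1, - p2)) with ((p1, p2) : C) by (apply C_ext; simpl; ring).
      ring. }
    rewrite <- poly2_scal, <- poly2_plus, <- H0, <- H1.
    apply C_ext; simpl; field.
  - pose proof (HB P H H1) as B.
    destruct H as (Pe & P0 & Pp & Ps), (B i k) as [B1 _], (B k i) as [B2 _].
    apply Pe with (2 := Ps (/ 2) _ (Pp _ _ B1 B2)); intros x y.
    destruct (b0 i k x y), (b0 k i x y); simpl; field.
  - pose proof (HB P H H1) as B.
    destruct H as (Pe & P0 & Pp & Ps), (B i k) as [_ B1], (B k i) as [_ B2].
    apply Pe with (2 := Ps (/ 2) _ (Pp _ _ B1 (Ps (-1) _ B2))); intros x y.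
    destruct (b0 i k x y), (b0 k i x y); simpl; field.
Qed.

(** * The magnetic bracket in complex momenta *)

Lemma Derive_of_cgrad g gx gy x y :
  has_cgrad (fun x y => RtoC (g x y)) gx gy ->
  RtoC (Derive (fun t => g t y) x) = gx x y /\ RtoC (Derive (fun t => g x t) y) = gy x y.
Proof.
  intros [(Hx & Hy & _) H2].
  destruct (has_grad_unique _ _ _ _ _ x y H2 (has_grad_const 0)) as [Zx Zy].
  split; apply C_ext; simpl.
  - apply is_derive_unique, Hx.
  - symmetry; exact Zx.
  - apply is_derive_unique, Hy.
  - symmetry; exact Zy.
Qed.

(** Formal derivatives in [xi] and [eta]. The bracket contains them only through [xi d/dxi] and
    [eta d/deta], which act diagonally on coefficients. *)
Definition poly2_d1 (n : nat) (c : nat -> nat -> C) (xi eta : C) : C :=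
  csum n (fun s => csum (S s) (fun i =>
    c i (s - i)%nat * (INR i * xi ^ pred i) * eta ^ (s - i))%C).

Definition poly2_d2 (n : nat) (c : nat -> nat -> C) (xi eta : C) : C :=
  csum n (fun s => csum (S s) (fun i =>
    c i (s - i)%nat * xi ^ i * (INR (s - i) * eta ^ pred (s - i)))%C).

Lemma poly2_euler1 n c xi eta :
  (xi * poly2_d1 n c xi eta = poly2 n (fun i k => INR i * c i k) xi eta)%C.
Proof.
  unfold poly2_d1, poly2; rewrite csum_scal; apply csum_ext; intros s _.
  unfold homog; rewrite csum_scal; apply csum_ext; intros [|i] _; simpl pred.
  - simpl; ring.
  - rewrite (Cpow_S xi i); ring.
Qed.

Lemma poly2_euler2 n c xi eta :
  (eta * poly2_d2 n c xi eta = poly2 n (fun i k => INR k * c i k) xi eta)%C.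
Proof.
  unfold poly2_d2, poly2; rewrite csum_scal; apply csum_ext; intros s _.
  unfold homog; rewrite csum_scal; apply csum_ext; intros i _.
  destruct (s - i)%nat as [|k]; simpl pred.
  - simpl; ring.
  - rewrite (Cpow_S eta k); ring.
Qed.

(** The chain rule [d/dp1 = d/dxi + d/deta], [d/dp2 = i (d/dxi - d/deta)]; here the momenta take the
    place of the variables of [has_cgrad]. *)
Lemma has_cgrad_momenta n c :
  has_cgrad (fun p1 p2 => poly2 n c (p1, p2) (p1, - p2))
    (fun p1 p2 => poly2_d1 n c (p1, p2) (p1, (- p2)%R)
                  + poly2_d2 n c (p1, p2) (p1, (- p2)%R))%C
    (fun p1 p2 => Ci * (poly2_d1 n c (p1, p2) (p1, (- p2)%R)
                        - poly2_d2 n c (p1, p2) (p1, (- p2)%R)))%C.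
Proof.
  assert (Hxi : has_cgrad (fun p1 p2 => (p1, p2)) (fun _ _ => 1) (fun _ _ => Ci))
    by (split; [apply has_grad_fst|apply has_grad_snd]).
  assert (Heta : has_cgrad (fun p1 p2 => (p1, - p2)) (fun _ _ => 1) (fun _ _ => - Ci)%C).
  { split.
    - apply has_grad_ext with (4 := has_grad_fst); intros; simpl; ring.
    - apply has_grad_ext with (4 := has_grad_opp _ _ _ has_grad_snd); intros; simpl; ring. }
  assert (Hm : forall s i, has_cgrad
    (fun p1 p2 => c i (s - i)%nat * (p1, p2) ^ i * (p1, (- p2)%R) ^ (s - i))%C
    (fun p1 p2 => c i (s - i)%nat * (INR i * (p1, p2) ^ pred i) * (p1, (- p2)%R) ^ (s - i)
      + c i (s - i)%nat * (p1, p2) ^ i * (INR (s - i) * (p1, (- p2)%R) ^ pred (s - i)))%C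
    (fun p1 p2 => Ci * (c i (s - i)%nat * (INR i * (p1, p2) ^ pred i) * (p1, (- p2)%R) ^ (s - i)
      - c i (s - i)%nat * (p1, p2) ^ i * (INR (s - i) * (p1, (- p2)%R) ^ pred (s - i))))%C).
  { intros s i.
    apply has_cgrad_ext with (4 := has_cgrad_mult _ _ _ _ _ _
      (has_cgrad_scal (c i (s - i)%nat) _ _ _ (has_cgrad_pow i _ _ _ Hxi))
      (has_cgrad_pow (s - i) _ _ _ Heta)); intros; simpl; ring. }
  apply has_cgrad_ext with (4 := has_cgrad_csum n _ _ _ (fun s => has_cgrad_csum (S s) _ _ _ (Hm s))).
  - reflexivity.
  - intros; unfold poly2_d1, poly2_d2; rewrite csum_plus; apply csum_ext; intros.
    now rewrite csum_plus.
  - intros p1 p2; unfold poly2_d1, poly2_d2.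
    transitivity (Ci * (csum n (fun s => csum (S s) (fun i =>
        c i (s - i)%nat * (INR i * (p1, p2) ^ pred i) * (p1, (- p2)%R) ^ (s - i))%C)
      + (-1) * csum n (fun s => csum (S s) (fun i =>
        c i (s - i)%nat * (p1, p2) ^ i * (INR (s - i) * (p1, (- p2)%R) ^ pred (s - i)))%C)))%C;
      [|ring].
    rewrite csum_scal, csum_plus, csum_scal; apply csum_ext; intros s _.
    rewrite csum_scal, csum_plus, csum_scal; apply csum_ext; intros i _; ring.
Qed.

Lemma has_cgrad_poly2 n b b_x b_y xi eta :
  (forall i k, has_cgrad (b i k) (b_x i k) (b_y i k)) ->
  has_cgrad (fun x y => poly2 n (fun i k => b i k x y) xi eta)
    (fun x y => poly2 n (fun i k => b_x i k x y) xi eta)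
    (fun x y => poly2 n (fun i k => b_y i k x y) xi eta).
Proof.
  intros H; unfold poly2, homog.
  apply has_cgrad_csum; intros s; apply has_cgrad_csum; intros i.
  apply has_cgrad_ext
    with (4 := has_cgrad_scal (xi ^ i * eta ^ (s - i)) _ _ _ (H i (s - i)%nat)); intros; ring.
Qed.

Lemma hamiltonian_derivatives (Lambda Lx Ly : R -> R -> R) x y p1 p2 :
  has_grad Lambda Lx Ly -> (forall x y, 0 < Lambda x y) ->
  d_x (hamiltonian Lambda) x y p1 p2 = (p1 ^ 2 + p2 ^ 2) / 2 * (- Lx x y / Lambda x y ^ 2) /\
  d_y (hamiltonian Lambda) x y p1 p2 = (p1 ^ 2 + p2 ^ 2) / 2 * (- Ly x y / Lambda x y ^ 2) /\
  d_p1 (hamiltonian Lambda) x y p1 p2 = p1 / Lambda x y /\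
  d_p2 (hamiltonian Lambda) x y p1 p2 = p2 / Lambda x y.
Proof.
  intros HL Lpos.
  assert (L0 : forall x y, Lambda x y <> 0) by (intros u v; apply Rgt_not_eq, Lpos).
  assert (HH : has_grad (fun x y => hamiltonian Lambda x y p1 p2)
    (fun x y => (p1 ^ 2 + p2 ^ 2) / 2 * (- Lx x y / Lambda x y ^ 2))
    (fun x y => (p1 ^ 2 + p2 ^ 2) / 2 * (- Ly x y / Lambda x y ^ 2))).
  { apply has_grad_ext with (4 := has_grad_scal ((p1 ^ 2 + p2 ^ 2) / 2) _ _ _
      (has_grad_inv _ _ _ L0 HL)); trivial.
    intros u v; unfold hamiltonian; field; apply L0. }
  destruct HH as (Hx & Hy & _).
  repeat split; apply is_derive_unique.
  - apply Hx.
  - apply Hy.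
  - unfold hamiltonian; auto_derive; [trivial|]; field; apply L0.
  - unfold hamiltonian; auto_derive; [trivial|]; field; apply L0.
Qed.

(* Coefficient of [xi^i eta^k] in [2 Lambda^2 {F, H}], where [L] is [Lambda(x, y)], [l1 + i l2]
   its gradient, [O] the field and [b], [b_x], [b_y] the coefficients of [F] and their gradients. *)
Definition bracket_coefficient (L l1 l2 O : R) (b b_x b_y : nat -> nat -> C) (i k : nat) : C :=
  (L * (shift1 (fun i k => b_x i k - Ci * b_y i k) i k
        + shift2 (fun i k => b_x i k + Ci * b_y i k) i k)
   + (l1 + Ci * l2) * shift2 (fun i k => INR i * b i k) i k
   + (l1 - Ci * l2) * shift1 (fun i k => INR k * b i k) i k
   - 2 * Ci * L * O * (INR i - INR k) * b i k)%C.

(** The factor [2 Lambda^2] clears the denominators coming from the derivatives of [H]. *)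
Lemma bracket_expansion N (Lambda Lx Ly Omega : R -> R -> R) F b b_x b_y x y p1 p2 :
  has_grad Lambda Lx Ly -> (forall x y, 0 < Lambda x y) ->
  (forall i k, has_cgrad (b i k) (b_x i k) (b_y i k)) ->
  (forall i k x y, (N < i + k)%nat -> b i k x y = 0) ->
  (forall x y p1 p2,
    RtoC (F x y p1 p2) = poly2 (S N) (fun i k => b i k x y) (p1, p2) (p1, - p2)) ->
  (2 * Lambda x y * Lambda x y * magnetic_bracket Omega F (hamiltonian Lambda) x y p1 p2)%C =
  poly2 (S (S N)) (bracket_coefficient (Lambda x y) (Lx x y) (Ly x y) (Omega x y)
    (fun i k => b i k x y) (fun i k => b_x i k x y) (fun i k => b_y i k x y)) (p1, p2) (p1, - p2).
Proof.
  intros HL Lpos Hb Zb HF.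
  assert (L0 : forall x y, Lambda x y <> 0) by (intros u v; apply Rgt_not_eq, Lpos).
  set (c := fun i k => b i k x y); set (cx := fun i k => b_x i k x y); set (cy := fun i k => b_y i k x y).
  set (xi := (p1, p2) : C); set (eta := (p1, - p2) : C).
  destruct (Derive_of_cgrad (fun x y => F x y p1 p2) _ _ x y
    (has_cgrad_ext _ _ _ _ _ _ (fun u v => eq_sym (HF u v p1 p2)) (fun _ _ => eq_refl)
      (fun _ _ => eq_refl) (has_cgrad_poly2 (S N) b b_x b_y xi eta Hb))) as [Fx Fy].
  destruct (Derive_of_cgrad (fun p1 p2 => F x y p1 p2) _ _ p1 p2
    (has_cgrad_ext _ _ _ _ _ _ (fun u v => eq_sym (HF x y u v)) (fun _ _ => eq_refl)
      (fun _ _ => eq_refl) (has_cgrad_momenta (S N) c))) as [F1 F2].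
  fold cx in Fx; fold cy in Fy; fold xi eta in F1, F2.
  destruct (hamiltonian_derivatives Lambda Lx Ly x y p1 p2 HL Lpos) as (Hx & Hy & H1 & H2).
  unfold magnetic_bracket; rewrite H1, H2.
  rewrite Hx, Hy.
  change (RtoC (d_x F x y p1 p2) = poly2 (S N) cx xi eta) in Fx.
  change (RtoC (d_y F x y p1 p2) = poly2 (S N) cy xi eta) in Fy.
  change (RtoC (d_p1 F x y p1 p2) = poly2_d1 (S N) c xi eta + poly2_d2 (S N) c xi eta)%C in F1.
  change (RtoC (d_p2 F x y p1 p2) = Ci * (poly2_d1 (S N) c xi eta - poly2_d2 (S N) c xi eta))%C in F2.
  assert (EP : poly2 (S (S N)) (bracket_coefficient (Lambda x y) (Lx x y) (Ly x y) (Omega x y)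
    c cx cy) xi eta =
    (Lambda x y * (xi * (poly2 (S N) cx xi eta - Ci * poly2 (S N) cy xi eta)
       + eta * (poly2 (S N) cx xi eta + Ci * poly2 (S N) cy xi eta))
     + (Lx x y + Ci * Ly x y) * (eta * (xi * poly2_d1 (S N) c xi eta))
     + (Lx x y - Ci * Ly x y) * (xi * (eta * poly2_d2 (S N) c xi eta))
     - 2 * Ci * Lambda x y * Omega x y * (xi * poly2_d1 (S N) c xi eta
         - eta * poly2_d2 (S N) c xi eta))%C).
  { assert (E1 : (poly2 (S N) cx xi eta - Ci * poly2 (S N) cy xi eta)%C
      = poly2 (S N) (fun i k => cx i k - Ci * cy i k)%C xi eta).
    { transitivity (poly2 (S N) cx xi eta + (- Ci) * poly2 (S N) cy xi eta)%C; [ring|].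
      rewrite poly2_scal, poly2_plus; apply poly2_ext; intros; ring. }
    assert (E2 : (poly2 (S N) cx xi eta + Ci * poly2 (S N) cy xi eta)%C
      = poly2 (S N) (fun i k => cx i k + Ci * cy i k)%C xi eta).
    { now rewrite poly2_scal, poly2_plus. }
    assert (E3 : (xi * poly2_d1 (S N) c xi eta - eta * poly2_d2 (S N) c xi eta)%C
      = poly2 (S (S N)) (fun i k => (INR i - INR k) * c i k)%C xi eta).
    { rewrite poly2_euler1, poly2_euler2.
      transitivity (poly2 (S N) (fun i k => INR i * c i k)%C xi eta
        + (-1) * poly2 (S N) (fun i k => INR k * c i k)%C xi eta)%C; [ring|].
      rewrite poly2_scal, poly2_plus.
      transitivity (poly2 (S N) (fun i k => (INR i - INR k) * c i k)%C xi eta).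
      - apply poly2_ext; intros; ring.
      - apply poly2_extend; intros i k Hik; unfold c; rewrite Zb by lia; ring. }
    rewrite E1, E2, E3, poly2_euler1, poly2_euler2, !poly2_shift1, !poly2_shift2.
    unfold Cminus.
    match goal with |- _ = (?u + - ?v)%C =>
      transitivity (u + (-1) * v)%C; [|ring] end.
    repeat (rewrite poly2_scal || rewrite poly2_plus).
    apply poly2_ext; intros i k; unfold bracket_coefficient, Cminus; ring. }
  rewrite EP.
  repeat rewrite ?RtoC_plus, ?RtoC_minus, ?RtoC_mult.
  rewrite Fx, Fy, F1, F2.
  assert (X1 : RtoC p1 = ((xi + eta) / 2)%C) by (apply C_ext; simpl; field).
  assert (X2 : RtoC p2 = (- Ci * (xi - eta) / 2)%C) by (apply C_ext; simpl; field).
  assert (X3 : RtoC ((p1 ^ 2 + p2 ^ 2) / 2) = (xi * eta / 2)%C) by (apply C_ext; simpl; field).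
  assert (LC : RtoC (Lambda x y) <> 0) by (intros X; apply (L0 x y), (f_equal Re X)).
  assert (X4 : RtoC (- Lx x y / Lambda x y ^ 2) = (- Lx x y / Lambda x y ^ 2)%C).
  { rewrite RtoC_div, RtoC_opp, RtoC_pow by (apply pow_nonzero, L0); reflexivity. }
  assert (X5 : RtoC (- Ly x y / Lambda x y ^ 2) = (- Ly x y / Lambda x y ^ 2)%C).
  { rewrite RtoC_div, RtoC_opp, RtoC_pow by (apply pow_nonzero, L0); reflexivity. }
  assert (X6 : RtoC (p1 / Lambda x y) = ((xi + eta) / 2 / Lambda x y)%C)
    by (rewrite RtoC_div, X1 by apply L0; reflexivity).
  assert (X7 : RtoC (p2 / Lambda x y) = (- Ci * (xi - eta) / 2 / Lambda x y)%C)
    by (rewrite RtoC_div, X2 by apply L0; reflexivity).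
  rewrite X3, X4, X5, X6, X7.
  assert (I2 : (Ci * Ci = -1)%C) by (apply C_ext; simpl; ring).
  (* What remains is a rational identity modulo [i^2 = -1]; with all ingredients made variables,
     [field] can decide it. *)
  generalize (poly2 (S N) cx xi eta) (poly2 (S N) cy xi eta) (poly2_d1 (S N) c xi eta)
    (poly2_d2 (S N) c xi eta).
  intros A B U W.
  revert I2 LC; generalize Ci, xi, eta, (RtoC (Lambda x y)), (RtoC (Lx x y)), (RtoC (Ly x y)),
    (RtoC (Omega x y)); intros I z w L l1 l2 O I2 LC.
  field [I2]; exact LC.
Qed.

(** * The theorem *)

Lemma nat_least (P : nat -> Prop) n :
  P n -> exists m, P m /\ forall k, (k < m)%nat -> ~ P k.
Proof.
  induction n as [n IH] using lt_wf_ind; intros Pn.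
  destruct (Classical_Prop.classic (exists k, (k < n)%nat /\ P k)) as [(k & Hk & Pk)|N].
  - now apply (IH k).
  - exists n; split; [exact Pn|]; intros k Hk Pk; apply N; eauto.
Qed.

Lemma nat_greatest (P : nat -> Prop) n N :
  P n -> (forall m, P m -> (m <= N)%nat) ->
  exists m, (n <= m)%nat /\ P m /\ forall k, (m < k)%nat -> ~ P k.
Proof.
  intros Pn B.
  destruct (nat_least (fun d => P (N - d)%nat /\ (d <= N)%nat) (N - n)%nat) as (d & (Pd & Hd) & Ld).
  - pose proof (B n Pn); replace (N - (N - n))%nat with n by lia; split; [exact Pn|lia].
  - exists (N - d)%nat; repeat split; [|exact Pd|].
    + apply Nat.nlt_ge; intros L; apply (Ld (N - n)%nat); [pose proof (B n Pn); lia|].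
      pose proof (B n Pn); replace (N - (N - n))%nat with n by lia; split; [exact Pn|lia].
    + intros k Hk Pk; pose proof (B k Pk); apply (Ld (N - k)%nat); [lia|].
      replace (N - (N - k))%nat with k by lia; split; [exact Pk|lia].
Qed.

Lemma linear_class_periodic Gamma : linear_class (periodic Gamma).
Proof.
  repeat split.
  - intros f g E Pf w Hw x y; rewrite <- !E; now apply Pf.
  - intros f g Pf Pg w Hw x y; now rewrite (Pf w Hw), (Pg w Hw).
  - intros k f Pf w Hw x y; now rewrite (Pf w Hw).
Qed.

Lemma real_analytic_0 : real_analytic (fun _ _ => 0).
Proof.
  intros x0 y0; exists (fun _ _ => 0), 1; split; [lra|]; intros x y _ _ term.
  assert (Z : forall n, 0 = sum_f_R0 (fun k => term n k) n).
  { intros n; unfold term; rewrite sum_eq_R0; [reflexivity|]; intros; ring. }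
  assert (S0 : is_series (fun _ : nat => 0) 0).
  { assert (Hh : Rabs (/ 2) < 1) by (rewrite Rabs_pos_eq; lra).
    pose proof (is_series_scal_l 0 _ _ (is_series_geom (/ 2) Hh)) as G.
    change (is_series (fun n => 0 * (/ 2) ^ n) (0 * / (1 - / 2))) in G.
    rewrite Rmult_0_l in G; apply is_series_ext with (2 := G); intros; apply Rmult_0_l. }
  split.
  - exists 0; apply is_series_ext with (2 := S0); intros n.
    unfold term; rewrite sum_eq_R0; [reflexivity|]; intros.
    rewrite !Rmult_0_l; apply Rabs_R0.
  - apply is_series_ext with (2 := S0); apply Z.
Qed.

Lemma linear_class_real_analytic : linear_class real_analytic.
Proof.
  repeat split.
  - exact real_analytic_ext.
  - exact real_analytic_0.
  - exact real_analytic_plus.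
  - exact real_analytic_scal.
Qed.

(** * Invariance along lines and the linear integral *)

Lemma has_grad_translation f fx fy c d :
  has_grad f fx fy -> (forall x y, f (x + c) (y + d) = f x y) ->
  forall x y, fx (x + c) (y + d) = fx x y /\ fy (x + c) (y + d) = fy x y.
Proof.
  intros H T x y; pose proof H as (Hx & Hy & _); split.
  - pose proof (is_derive_curve f fx fy (fun s => s + c) (fun _ => y + d) x 1 0 H) as D.
    rewrite <- (is_derive_unique _ _ _ (Hx x y)).
    rewrite <- (Derive_ext (fun s => f (s + c) (y + d))) by (intros; apply T).
    erewrite is_derive_unique; [|apply D; auto_derive; trivial; ring].
    ring.
  - pose proof (is_derive_curve f fx fy (fun _ => x + c) (fun s => s + d) y 0 1 H) as D.
    rewrite <- (is_derive_unique _ _ _ (Hy x y)).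
    rewrite <- (Derive_ext (fun s => f (x + c) (s + d))) by (intros; apply T).
    erewrite is_derive_unique; [|apply D; auto_derive; trivial; ring].
    ring.
Qed.

Lemma depends_only_on_of_lines v1 v2 f :
  v1 <> 0 \/ v2 <> 0 -> (forall x y t, f (x + t * v1) (y + t * v2) = f x y) ->
  depends_only_on v2 (- v1) f.
Proof.
  intros N L.
  assert (D : v1 ^ 2 + v2 ^ 2 <> 0) by (destruct N; nra).
  (* The sample point is the foot of the perpendicular from the origin to the line
     [v2 x - v1 y = s]. *)
  exists (fun s => f (s * v2 / (v1 ^ 2 + v2 ^ 2)) (- s * v1 / (v1 ^ 2 + v2 ^ 2))).
  intros x y.
  rewrite <- (L x y (- (v1 * x + v2 * y) / (v1 ^ 2 + v2 ^ 2))).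
  f_equal; field; exact D.
Qed.

(** The magnetic part of the bracket of [v . p + A] with [H] cancels when
    [grad A = (v2 Omega, - v1 Omega)]; the rest is a multiple of [v . grad Lambda]. Together,
    [2 d h = 2 Omega] and [v . grad h = 0] show that the combination [A] of [Re h] and [Im h] has
    this gradient, and it is periodic because [h] is. *)
Lemma linear_integral Gamma (Lambda Lx Ly Omega : R -> R -> R) (v1 v2 : R) (h hx hy : R -> R -> C) :
  has_grad Lambda Lx Ly -> (forall x y, 0 < Lambda x y) -> smooth Omega ->
  v1 <> 0 \/ v2 <> 0 -> has_cgrad h hx hy -> cperiodic Gamma h ->
  (forall x y, hx x y - Ci * hy x y = RtoC (2 * Omega x y)%R)%C ->
  (forall x y, hx x y * v1 + hy x y * v2 = 0)%C ->
  (forall x y, Lx x y * v1 + Ly x y * v2 = 0) ->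
  exists F1, polynomial_in_momenta smooth Gamma 1 F1 /\
    first_integral_on_all_levels Lambda Omega F1.
Proof.
  intros HL Lpos SO N [H1 H2] Ph Hh Hv Lv.
  set (A := fun x y => / 2 * (v2 * Re (h x y) + - (v1 * Im (h x y)))).
  assert (HA : has_grad A (fun x y => v2 * Omega x y) (fun x y => - v1 * Omega x y)).
  { apply has_grad_ext with (4 := has_grad_scal (/ 2) _ _ _ (has_grad_plus _ _ _ _ _ _
      (has_grad_scal v2 _ _ _ H1) (has_grad_opp _ _ _ (has_grad_scal v1 _ _ _ H2)))).
    - reflexivity.
    - intros x y; generalize (f_equal Re (Hh x y)) (f_equal Im (Hh x y))
        (f_equal Re (Hv x y)) (f_equal Im (Hv x y)).
      destruct (hx x y) as [a b], (hy x y) as [c d]; unfold Re, Im; simpl; intros E1 E2 E3 E4.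
      replace (Omega x y) with ((a + d) / 2) by lra; lra.
    - intros x y; generalize (f_equal Re (Hh x y)) (f_equal Im (Hh x y))
        (f_equal Re (Hv x y)) (f_equal Im (Hv x y)).
      destruct (hx x y) as [a b], (hy x y) as [c d]; unfold Re, Im; simpl; intros E1 E2 E3 E4.
      replace (Omega x y) with ((a + d) / 2) by lra; replace c with b in * by lra; lra. }
  exists (fun x y p1 p2 => v1 * p1 + v2 * p2 + A x y); split.
  - exists (fun s k => match s, k with
                       | O, _ => A
                       | S _, O => fun _ _ => v1
                       | S _, S _ => fun _ _ => v2
                       end).
    split; [|split].
    + intros [|s] k _; [|destruct k].
      * split.
        -- intros w Hw x y; unfold A; now rewrite (Ph w Hw).
        -- apply smooth_of_grad with (1 := HA); now apply smooth_scal.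
      * split; [intros w Hw x y; reflexivity|apply smooth_const].
      * split; [intros w Hw x y; reflexivity|apply smooth_const].
    + destruct N; [exists 0%nat|exists 1%nat]; (split; [lia|]); now exists 0, 0.
    + intros x y p1 p2; simpl; ring.
  - intros x y p1 p2.
    destruct (hamiltonian_derivatives Lambda Lx Ly x y p1 p2 HL Lpos) as (Ex & Ey & E1 & E2).
    set (F1 := fun x y p1 p2 => v1 * p1 + v2 * p2 + A x y).
    assert (D1 : d_p1 F1 x y p1 p2 = v1).
    { apply is_derive_unique; unfold F1; auto_derive; trivial; ring. }
    assert (D2 : d_p2 F1 x y p1 p2 = v2).
    { apply is_derive_unique; unfold F1; auto_derive; trivial; ring. }
    destruct HA as (Ax & Ay & _).
    assert (Dx : d_x F1 x y p1 p2 = v2 * Omega x y).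
    { apply is_derive_unique; unfold F1.
      rewrite <- (Rplus_0_l (v2 * Omega x y)).
      apply (@is_derive_plus R_AbsRing R_NormedModule); [apply @is_derive_const|apply Ax]. }
    assert (Dy : d_y F1 x y p1 p2 = - v1 * Omega x y).
    { apply is_derive_unique; unfold F1.
      rewrite <- (Rplus_0_l (- v1 * Omega x y)).
      apply (@is_derive_plus R_AbsRing R_NormedModule); [apply @is_derive_const|apply Ay]. }
    unfold magnetic_bracket; rewrite Ex, Ey, E1, E2, D1, D2, Dx, Dy.
    transitivity ((p1 ^ 2 + p2 ^ 2) / (2 * Lambda x y ^ 2) * (Lx x y * v1 + Ly x y * v2)).
    + field; apply Rgt_not_eq, Lpos.
    + rewrite Lv; ring.
Qed.

(** * The equations of one row of coefficients *)

Section Rows.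

Context (Gamma : R * R -> Prop) (HG : is_lattice Gamma).
Context (Lambda Lx Ly Omega : R -> R -> R) (HL : has_grad Lambda Lx Ly).
Context (Lpos : forall x y, 0 < Lambda x y) (PL : periodic Gamma Lambda).
Context (b b_x b_y : nat -> nat -> R -> R -> C) (N : nat).
Context (Hb : forall i k, has_cgrad (b i k) (b_x i k) (b_y i k)).
Context (Pb : forall i k, cperiodic Gamma (b i k)).
Context (herm : forall i k x y, b k i x y = Cconj (b i k x y)).
Context (deg : forall i k x y, (N < i + k)%nat -> b i k x y = 0).
Context (Zero : forall i k x y, bracket_coefficient (Lambda x y) (Lx x y) (Ly x y) (Omega x y)
  (fun i k => b i k x y) (fun i k => b_x i k x y) (fun i k => b_y i k x y) i k = 0).

Lemma grad_of_zero i k x y :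
  (forall x y, b i k x y = 0) -> b_x i k x y = 0 /\ b_y i k x y = 0.
Proof.
  intros Z; apply (has_cgrad_locally_const _ _ _ x y 0 (Hb i k)).
  apply locally_2d_forall; exact Z.
Qed.

(* [weighted m j] is the coefficient of [xi^m] in row [j], where powers of [eta] have been
   traded for powers of [H] through [xi eta = 2 Lambda H]. *)
Definition weighted (m j : nat) (x y : R) : C := (Lambda x y ^ j * b (m + j) j x y)%C.
Definition weighted_x (m j : nat) (x y : R) : C :=
  (INR j * Lambda x y ^ pred j * Lx x y * b (m + j) j x y + Lambda x y ^ j * b_x (m + j) j x y)%C.
Definition weighted_y (m j : nat) (x y : R) : C :=
  (INR j * Lambda x y ^ pred j * Ly x y * b (m + j) j x y + Lambda x y ^ j * b_y (m + j) j x y)%C.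

Lemma has_cgrad_weighted m j : has_cgrad (weighted m j) (weighted_x m j) (weighted_y m j).
Proof.
  exact (has_cgrad_mult _ _ _ _ _ _ (has_cgrad_pow j _ _ _ (has_cgrad_RtoC _ _ _ HL))
    (Hb (m + j) j)).
Qed.

Lemma cperiodic_weighted m j : cperiodic Gamma (weighted m j).
Proof. intros w Hw x y; unfold weighted; now rewrite (PL w Hw), (Pb _ _ w Hw). Qed.

Lemma Lambda_neq_0 x y : RtoC (Lambda x y) <> 0.
Proof. intros E; apply (Rgt_not_eq _ _ (Lpos x y)), (f_equal Re E). Qed.

Lemma pow_pred_mult (z : C) j : (z * (INR j * z ^ pred j) = INR j * z ^ j)%C.
Proof. destruct j; [simpl; ring|]; simpl pred; rewrite (Cpow_S z j); ring. Qed.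

Context (j : nat) (below : forall i k x y, (k < j)%nat -> (k < i)%nat -> b i k x y = 0).

(** The coefficient of [xi^(m+j+1) eta^j] in the bracket. Row [j - 1] drops out by [below], and
    [Lambda^j] is the integrating factor that absorbs the term with [j] times the derivative of
    [Lambda]. *)
Lemma weighted_equation m x y :
  (weighted_x m j x y - Ci * weighted_y m j x y =
   2 * Ci * INR (S m) * Omega x y * weighted (S m) j x y)%C.
Proof.
  assert (E : (Lambda x y * (b_x (m + j) j x y - Ci * b_y (m + j) j x y)
    + (Lx x y - Ci * Ly x y) * (INR j * b (m + j) j x y)
    = 2 * Ci * Lambda x y * Omega x y * INR (S m) * b (S (m + j)) j x y)%C).
  { assert (S2 : shift2 (fun i k => b_x i k x y + Ci * b_y i k x y)%C (S (m + j)) j = 0 /\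
      shift2 (fun i k => INR i * b i k x y)%C (S (m + j)) j = 0).
    { destruct j as [|j']; [split; reflexivity|]; simpl shift2.
      assert (Z : forall u v, b (S (m + S j')) j' u v = 0) by (intros; apply below; lia).
      destruct (grad_of_zero _ _ x y Z) as [-> ->]; rewrite Z; split; ring. }
    destruct S2 as [S2 S3].
    pose proof (Zero (S (m + j)) j x y) as Z; unfold bracket_coefficient in Z.
    rewrite S2, S3 in Z; simpl shift1 in Z.
    replace (RtoC (INR (S (m + j))) - RtoC (INR j))%C with (RtoC (INR (S m))) in Z.
    2: { rewrite <- RtoC_minus, !S_INR, plus_INR; f_equal; ring. }
    apply Ceq_minus; rewrite <- Z; ring. }
  assert (L0 := Lambda_neq_0 x y).
  (* An extra factor [Lambda] turns [Lambda^(pred j)] into [Lambda^j]; [pow_pred_mult] covers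
     [j = 0] as well, thanks to the factor [j]. *)
  assert (M : (Lambda x y * (weighted_x m j x y - Ci * weighted_y m j x y) =
    Lambda x y * (2 * Ci * INR (S m) * Omega x y * weighted (S m) j x y))%C).
  { transitivity (Lambda x y ^ j * (Lambda x y * (b_x (m + j) j x y - Ci * b_y (m + j) j x y)
      + (Lx x y - Ci * Ly x y) * (INR j * b (m + j) j x y)))%C.
    - unfold weighted_x, weighted_y.
      transitivity (Lambda x y * (INR j * Lambda x y ^ pred j) * (Lx x y - Ci * Ly x y)
        * b (m + j) j x y + Lambda x y ^ j * (Lambda x y * (b_x (m + j) j x y
        - Ci * b_y (m + j) j x y)))%C; [ring|].
      rewrite pow_pred_mult; ring.
    - rewrite E; unfold weighted; simpl (S m + j)%nat; ring. }
  transitivity (/ Lambda x y * (Lambda x y * (weighted_x m j x y - Ci * weighted_y m j x y)))%C.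
  - field; exact L0.
  - rewrite M; field; exact L0.
Qed.

(** The coefficient of [(xi eta)^(j+1)]: the magnetic term has the factor [i - k = 0], and the two
    neighbours are conjugate by [herm]. Since [e_1 = i g_1], the field [V = (Im e_1, Re e_1)]
    appears here as [(Re g_1, - Im g_1)]. *)
Lemma weighted_divergence x y :
  Lx x y * Re (weighted 1 j x y) - Ly x y * Im (weighted 1 j x y)
  + Lambda x y * (Re (weighted_x 1 j x y) - Im (weighted_y 1 j x y)) = 0.
Proof.
  set (u := b_x (S j) j x y); set (v := b_y (S j) j x y); set (w := b (S j) j x y).
  assert (Hc : b_x j (S j) x y = Cconj u /\ b_y j (S j) x y = Cconj v).
  { apply (has_cgrad_unique (b j (S j)) _ _ (fun x y => Cconj (b_x (S j) j x y))
      (fun x y => Cconj (b_y (S j) j x y)) x y (Hb j (S j))).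
    apply has_cgrad_ext with (4 := has_cgrad_conj _ _ _ (Hb (S j) j)); trivial.
    intros s t; symmetry; apply herm. }
  destruct Hc as [Hu Hv].
  pose proof (Zero (S j) (S j) x y) as Z; unfold bracket_coefficient in Z.
  cbn [shift1 shift2] in Z.
  rewrite Hu, Hv, (herm (S j) j x y) in Z; fold u v w in Z.
  apply (f_equal Re) in Z.
  assert (E : INR (S j) * (Lx x y * Re w - Ly x y * Im w) + Lambda x y * (Re u - Im v) = 0).
  { revert Z; generalize (INR (S j)); intros n.
    destruct u, v, w; unfold Re, Im; simpl; lra. }
  assert (P : Lambda x y * (INR j * Lambda x y ^ pred j) = INR j * Lambda x y ^ j).
  { destruct j; simpl; ring. }
  assert (RW : forall n p (z : C), (p = RtoC n)%C -> Re (p * z)%C = n * Re z /\ Im (p * z)%C = n * Im z).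
  { intros n p [z1 z2] ->; unfold Re, Im; simpl; split; ring. }
  assert (Pj : (Lambda x y ^ j)%C = RtoC (Lambda x y ^ j)) by (symmetry; apply RtoC_pow).
  assert (Px : (INR j * Lambda x y ^ pred j * Lx x y)%C
    = RtoC (INR j * Lambda x y ^ pred j * Lx x y)) by now rewrite !RtoC_mult, RtoC_pow.
  assert (Py : (INR j * Lambda x y ^ pred j * Ly x y)%C
    = RtoC (INR j * Lambda x y ^ pred j * Ly x y)) by now rewrite !RtoC_mult, RtoC_pow.
  unfold weighted, weighted_x, weighted_y; simpl (1 + j)%nat; fold u v w.
  assert (RP : forall a c : C, Re (a + c)%C = Re a + Re c /\ Im (a + c)%C = Im a + Im c)
    by (intros; split; reflexivity).
  rewrite (proj1 (RP _ _)), (proj2 (RP _ _)), (proj1 (RW _ _ w Pj)), (proj2 (RW _ _ w Pj)),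
    (proj1 (RW _ _ u Pj)), (proj2 (RW _ _ v Pj)), (proj1 (RW _ _ w Px)), (proj2 (RW _ _ w Py)).
  transitivity (Lambda x y ^ j * (Lx x y * Re w - Ly x y * Im w)
    + Lambda x y * (INR j * Lambda x y ^ pred j) * (Lx x y * Re w - Ly x y * Im w)
    + Lambda x y * Lambda x y ^ j * (Re u - Im v)); [ring|].
  rewrite P.
  transitivity (Lambda x y ^ j * (INR (S j) * (Lx x y * Re w - Ly x y * Im w)
    + Lambda x y * (Re u - Im v))); [rewrite S_INR; ring|].
  rewrite E; ring.
Qed.

Lemma rows_periodic_potential :
  (forall x y, continuity_2d_pt Omega x y) -> (exists x y, Omega x y <> 0) ->
  (forall i k, real_analytic (fun x y => Re (b i k x y)) /\
     real_analytic (fun x y => Im (b i k x y))) ->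
  (exists i x y, (j < i)%nat /\ b i j x y <> 0) ->
  exists (v1 v2 : R) (h hx hy : R -> R -> C),
  (v1 <> 0 \/ v2 <> 0) /\ has_cgrad h hx hy /\ cperiodic Gamma h /\
  (forall x y, hx x y - Ci * hy x y = RtoC (2 * Omega x y)%R)%C /\
  (forall x y, hx x y * v1 + hy x y * v2 = 0)%C /\
  (forall x y, Lx x y * v1 + Ly x y * v2 = 0).
Proof.
  intros CO NO An (i & x1 & y1 & Hi & N1).
  assert (WZ : forall m x y, weighted m j x y = 0 <-> b (m + j) j x y = 0).
  { intros m x y; unfold weighted; split; intros Z.
    - apply Classical_Prop.NNPP; intros X.
      apply (Cmult_neq_0 (Lambda x y ^ j)%C (b (m + j) j x y)); trivial.
      apply Cpow_nz, Lambda_neq_0.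
    - rewrite Z; ring. }
  destruct (nat_greatest (fun m => exists x y, weighted m j x y <> 0) (i - j) N)
    as (M & HM & NM & LM).
  { exists x1, y1; intros Z; apply WZ in Z; apply N1; now replace i with (i - j + j)%nat by lia. }
  { intros m (x & y & X); apply Nat.nlt_ge; intros L; apply X, WZ, deg; lia. }
  set (k := fun m => (Ci ^ m * INR (fact m))%C).
  assert (k0 : forall m, k m <> 0).
  { intros m; apply Cmult_neq_0; [apply Cpow_nz, Ci_nz|apply RtoC_fact_neq_0]. }
  assert (kS : forall m, (k m * (Ci * INR (S m)) = k (S m))%C).
  { intros m; unfold k; rewrite fact_simpl, mult_INR, RtoC_mult, (Cpow_S Ci m); ring. }
  apply (periodic_potential Gamma HG Lambda Lx Ly Omega HL Lpos CO NO
    (fun m x y => k m * weighted m j x y)%C (fun m x y => k m * weighted_x m j x y)%C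
    (fun m x y => k m * weighted_y m j x y)%C M).
  - intros m; apply has_cgrad_scal, has_cgrad_weighted.
  - intros m w Hw x y; now rewrite (cperiodic_weighted m j w Hw).
  - lia.
  - destruct NM as (x & y & X); exists x, y; now apply Cmult_neq_0.
  - intros m x y Hm; replace (weighted m j x y) with (RtoC 0); [ring|].
    symmetry; apply Classical_Prop.NNPP; intros X; apply (LM m Hm); eauto.
  - intros m x y; rewrite <- kS.
    transitivity (k m * (weighted_x m j x y - Ci * weighted_y m j x y))%C; [ring|].
    rewrite weighted_equation, RtoC_mult; ring.
  - intros x y; unfold k, weighted; simpl (0 + j)%nat.
    assert (I0 : Im (b j j x y) = 0).
    { generalize (f_equal Im (herm j j x y)); simpl; unfold Im; lra. }
    rewrite <- RtoC_pow; destruct (b j j x y) as [p q]; simpl in I0; subst q.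
    unfold Im; simpl; ring.
  - intros x y; rewrite <- (weighted_divergence x y).
    unfold k; destruct (weighted 1 j x y), (weighted_x 1 j x y), (weighted_y 1 j x y).
    unfold Re, Im; simpl; ring.
  (* The factor [Lambda^j] never vanishes, so the zeros are those of the analytic coefficient
     [b (1 + j) j], to which the identity theorem applies. *)
  - intros x y [d Z].
    assert (Zb : forall u v, b (1 + j) j u v = 0).
    { intros u v; destruct (An (1 + j)%nat j) as [A1 A2].
      assert (L : forall s t, Rabs (s - x) < d -> Rabs (t - y) < d -> b (1 + j) j s t = 0).
      { intros s t Hs Ht; apply WZ, Classical_Prop.NNPP; intros X.
        apply (Cmult_neq_0 _ _ (k0 1%nat) X), Z; assumption. }
      apply C_ext.
      - apply (real_analytic_continuation _ x y A1); exists d; intros; now rewrite L.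
      - apply (real_analytic_continuation _ x y A2); exists d; intros; now rewrite L. }
    intros u v; rewrite (proj2 (WZ 1%nat u v) (Zb u v)); ring.
Qed.

End Rows.

Theorem theorem3 :
  forall (N : nat) (Gamma : R * R -> Prop) (Lambda Omega : R -> R -> R)
         (F : R -> R -> R -> R -> R) (E : nat -> R),
    (4 < N)%nat ->
    is_lattice Gamma ->
    smooth Lambda -> periodic Gamma Lambda ->
    (forall x y : R, 0 < Lambda x y) ->
    smooth Omega -> periodic Gamma Omega ->
    (exists x y : R, Omega x y <> 0) ->
    polynomial_in_momenta real_analytic Gamma N F ->
    (forall i : nat, (i < N + 2)%nat -> 0 < E i) ->
    (forall i j : nat, (i < N + 2)%nat -> (j < N + 2)%nat ->
       i <> j -> E i <> E j) ->
    (forall i : nat, (i < N + 2)%nat ->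
       first_integral_on_level Lambda Omega F (E i) /\
       ~ constant_on_level Lambda F (E i)) ->
    (exists alpha beta : R,
       (alpha, beta) <> (0, 0) /\
       depends_only_on alpha beta Omega /\
       depends_only_on alpha beta Lambda) /\
    (exists F1 : R -> R -> R -> R -> R,
       polynomial_in_momenta smooth Gamma 1 F1 /\
       first_integral_on_all_levels Lambda Omega F1).
Proof.
  intros N Gamma Lambda Omega F E _ HG SL PL Lpos SO _ NO (a & Ha & _ & HF) HE HD HI.
  destruct (complex_coefficients N F a HF) as (b & deg & herm & HFb & cls).
  pose proof (smooth_has_grad _ SL) as HL.
  set (Lx := fun x y => Derive (fun t => Lambda t y) x) in HL.
  set (Ly := fun x y => Derive (fun t => Lambda x t) y) in HL.
  pose proof (cls _ linear_class_real_analytic (fun s k H => proj2 (Ha s k H))) as An.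
  pose proof (cls _ (linear_class_periodic Gamma) (fun s k H => proj1 (Ha s k H))) as Per.
  set (b_x := fun i k x y => (Derive (fun t => Re (b i k t y)) x,
                             Derive (fun t => Im (b i k t y)) x) : C).
  set (b_y := fun i k x y => (Derive (fun t => Re (b i k x t)) y,
                              Derive (fun t => Im (b i k x t)) y) : C).
  assert (Hb : forall i k, has_cgrad (b i k) (b_x i k) (b_y i k)).
  { intros i k; destruct (An i k) as [A1 A2].
    split; [exact (real_analytic_has_grad _ A1)|exact (real_analytic_has_grad _ A2)]. }
  assert (Pb : forall i k, cperiodic Gamma (b i k)).
  { intros i k w Hw x y; destruct (Per i k) as [P1 P2].
    apply C_ext; [exact (P1 w Hw x y)|exact (P2 w Hw x y)]. }
  assert (Zero : forall i k x y, bracket_coefficient (Lambda x y) (Lx x y) (Ly x y) (Omega x y)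
    (fun i k => b i k x y) (fun i k => b_x i k x y) (fun i k => b_y i k x y) i k = 0).
  (* Beyond total degree [N + 1] every ingredient is 0 by [deg]; up to it, the [N + 2] levels are
     exactly what [poly2_zero] asks for. *)
  { intros i k x y; destruct (le_lt_dec (S (S N)) (i + k)) as [H|H].
    - unfold bracket_coefficient; rewrite deg by lia.
      assert (G : forall i k, (N < i + k)%nat -> b_x i k x y = 0 /\ b_y i k x y = 0).
      { intros p q Hpq; apply (grad_of_zero b b_x b_y Hb); intros; now apply deg. }
      assert (S1 : shift1 (fun i k => b_x i k x y - Ci * b_y i k x y)%C i k = 0 /\
        shift1 (fun i k => INR k * b i k x y)%C i k = 0).
      { destruct i as [|i]; [split; reflexivity|]; simpl shift1.
        destruct (G i k ltac:(lia)) as [-> ->]; rewrite deg by lia; split; ring. }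
      assert (S2 : shift2 (fun i k => b_x i k x y + Ci * b_y i k x y)%C i k = 0 /\
        shift2 (fun i k => INR i * b i k x y)%C i k = 0).
      { destruct k as [|k]; [split; reflexivity|]; simpl shift2.
        destruct (G i k ltac:(lia)) as [-> ->]; rewrite deg by lia; split; ring. }
      destruct S1 as [-> ->], S2 as [-> ->]; ring.
    - apply (poly2_zero (S (S N)) _ (Lambda x y) E (Lpos x y)); [| | |exact H].
      + intros l Hl; apply HE; lia.
      + intros l m Hl Hm; apply HD; lia.
      + intros l p1 p2 Hl Hp.
        rewrite <- (bracket_expansion N Lambda Lx Ly Omega F b b_x b_y x y p1 p2 HL Lpos Hb deg HFb).
        destruct (HI l ltac:(lia)) as [HI1 _].
        rewrite (HI1 x y p1 p2 Hp); ring. }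
  destruct (Classical_Prop.classic (exists j, exists i x y, (j < i)%nat /\ b i j x y <> 0))
    as [(j0 & Hj0)|NJ].
  - destruct (nat_least (fun j => exists i x y, (j < i)%nat /\ b i j x y <> 0) j0 Hj0)
      as (j & Hj & Lj).
    destruct (rows_periodic_potential Gamma HG Lambda Lx Ly Omega HL Lpos PL b b_x b_y N Hb Pb
      herm deg Zero j) as (v1 & v2 & h & hx & hy & Nv & Hh & Ph & dh & hv & Lv); trivial.
    { intros i k x y Hk Hi; apply Classical_Prop.NNPP; intros X; apply (Lj k Hk); eauto. }
    { intros x y; apply (SO 0%nat x y). }
    split.
    + exists v2, (- v1); split; [|split].
      * intros X; injection X; intros X1 X2; destruct Nv; lra.
      * apply depends_only_on_of_lines; [exact Nv|]; intros x y t.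
        (* [h] is available only as a C^1 function, so the invariance of [Omega], a combination of
           its first derivatives, is obtained by translating [h] instead of differentiating
           again. *)
        assert (T : forall u v, h (u + t * v1) (v + t * v2) = h u v).
        { intros u v; apply (has_cgrad_const_line _ _ _ u v v1 v2 Hh); intros; apply hv. }
        destruct Hh as [Hr Hm].
        destruct (has_grad_translation _ _ _ (t * v1) (t * v2) Hr
          (fun u v => f_equal Re (T u v)) x y) as [T1 _].
        destruct (has_grad_translation _ _ _ (t * v1) (t * v2) Hm
          (fun u v => f_equal Im (T u v)) x y) as [_ T2].
        generalize (f_equal Re (dh x y)) (f_equal Re (dh (x + t * v1) (y + t * v2))).
        revert T1 T2; unfold Re, Im; simpl; lra.
      * apply depends_only_on_of_lines; [exact Nv|]; intros x y.
        apply (has_grad_const_line _ _ _ x y v1 v2 HL); intros; apply Lv.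
    + exact (linear_integral Gamma Lambda Lx Ly Omega v1 v2 h hx hy HL Lpos SO Nv Hh Ph dh hv Lv).
  (* Without entries off the diagonal, [F] is a polynomial in [xi eta = 2 Lambda H] whose
     coefficients, after the factor [Lambda^k] is moved over, are constants by Liouville. Hence [F]
     is constant on the first level, a contradiction. *)
  - exfalso; destruct (HI 0%nat ltac:(lia)) as [_ NC]; apply NC.
    assert (off : forall i k x y, i <> k -> b i k x y = 0).
    { assert (lt0 : forall i k x y, (k < i)%nat -> b i k x y = 0).
      { intros i k x y H; apply Classical_Prop.NNPP; intros X; apply NJ; exists k, i, x, y; easy. }
      intros i k x y H; destruct (Nat.lt_total i k) as [L|[L|L]]; [|easy|now apply lt0].
      rewrite (herm k i), lt0 by exact L; apply C_ext; simpl; ring. }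
    (* At [m = 0] the right-hand side of [weighted_equation] is an off-diagonal entry, so each
       weighted diagonal entry is antiholomorphic. *)
    assert (K : forall k x y, weighted Lambda b 0 k x y = weighted Lambda b 0 k 0 0).
    { intros k; apply (antiholomorphic_liouville Gamma _ _ _ HG
        (cperiodic_weighted Gamma Lambda PL b Pb 0 k)
        (has_cgrad_weighted Lambda Lx Ly HL b b_x b_y Hb 0 k)).
      intros x y; rewrite (weighted_equation Lambda Lx Ly Omega Lpos b b_x b_y Hb Zero k).
      - unfold weighted; rewrite off by lia; ring.
      - intros; apply off; lia. }
    exists (Re (csum (S N) (fun s => csum (S s) (fun i =>
      if Nat.eq_dec i (s - i) then weighted Lambda b 0 i 0 0 * RtoC (2 * E 0%nat) ^ i else RtoC 0)%C))).
    intros x y p1 p2 Hp.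
    transitivity (Re (RtoC (F x y p1 p2))); [reflexivity|]; f_equal.
    rewrite HFb; apply csum_ext; intros s _; apply csum_ext; intros i _.
    destruct (Nat.eq_dec i (s - i)) as [D|D].
    + rewrite <- D, <- (K i x y); unfold weighted; simpl (0 + i)%nat.
      transitivity (b i i x y * ((p1, p2) * (p1, (- p2)%R)) ^ i)%C; [rewrite Cpow_mult_l; ring|].
      replace ((p1, p2) * (p1, (- p2)%R))%C with (Lambda x y * RtoC (2 * E 0%nat))%C.
      * rewrite Cpow_mult_l; ring.
      * rewrite <- Hp; unfold hamiltonian; pose proof (Lpos x y).
        apply C_ext; simpl; field; lra.
    + rewrite off by exact D; ring.
Qed.
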